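(* Let $G$ be a rational Carnot group of Hausdorff dimension $Q\ge3$ with a weighted infinity metric $d=d_{\infty,\Lambda}$. For $C>0$, $g\in G$ and $N\in\mathbb{N}$ let $A_C(g,N)$ denote the number of solutions $(p,q)$ to $$d(g,\delta_q^{-1}p)\le C\,q^{-\frac{Q+1}{Q}},\qquad p\in G(\mathbb{Z}),\ q\in\mathbb{N},\ 1\le q\le N.$$ Let $C>0$ and $\epsilon>0$ be fixed. Then for almost all $g\in G$, as $N\to\infty$, $$A_C(g,N)=B_\Lambda\cdot C^Q\log N+O\!\left((\log N)^{1/2}(\log\log N)^{3/2+\epsilon}\right),$$ where $B_\Lambda$ is the Lebesgue measure of the unit ball of $d_{\infty,\Lambda}$ around the origin.
   Context: A connected, simply connected Lie group $G$ with Lie algebra $\mathfrak g$ is a Carnot group if $\mathfrak g=\mathfrak g_1\oplus\cdots\oplus\mathfrak g_s$ with $[\mathfrak g_1,\mathfrak g_i]=\mathfrak g_{i+1}$ for all $i$ (with $\mathfrak g_{s+1}:=0$). Let $n_i=\dim\mathfrak g_i$, $n=\sum_in_i$. Via the exponential map (a bijection) and a choice of basis of each $\mathfrak g_i$, $G$ is given coordinates in $\mathbb{R}^{n_1}\times\cdots\times\mathbb{R}^{n_s}$, and the group law has the form $(x_1,\dots,x_s)*(x_1',\dots,x_s')=(x_1+x_1',x_2+x_2'+p_2,\dots,x_s+x_s'+p_s)$, where $p_i$ is a vector of polynomials in the coordinates of $x_1,\dots,x_{i-1},x_1',\dots,x_{i-1}'$. $G$ is rational if these coordinates can be chosen so that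 all $p_i$ have integer coefficients; such coordinates are fixed. $G(\mathbb{Z})$ is the set of points with integer coordinates. Dilations: $\delta_r(x_1,\dots,x_s)=(rx_1,r^2x_2,\dots,r^sx_s)$, $r>0$. Given positive weights $\Lambda=\{\lambda_1,\dots,\lambda_s\}$, the weighted infinity metric is $d_{\infty,\Lambda}(g,g')=\|g^{-1}*g'\|_{\infty,\Lambda}$, where $\|(x_1,\dots,x_s)\|_{\infty,\Lambda}$ is the maximum, over $i=1,\dots,s$ and over the real coordinates $x$ of the vector $x_i$, of $|\lambda_ix|^{1/i}$. It is assumed that $\Lambda$ is chosen so that $d_{\infty,\Lambda}$ is a metric (satisfies the triangle inequality). One has $B_\Lambda=2^n\prod_{i=1}^s\lambda_i^{-n_i}$. The Hausdorff dimension is $Q=\sum_i i\,n_i$. ''Almost all'' refers to Lebesgue measure in the coordinates (a Haar measure). The implied constant may depend on $g$. Solutions are counted as pairs $(p,q)$, with no lowest-terms restriction. *)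

(* Defs.v *)
From HB Require Import structures.
From mathcomp Require Import all_boot all_order all_algebra.
From mathcomp Require Import finmap.
From mathcomp Require Import -(notations) mpoly.
From mathcomp Require Import all_classical all_reals all_analysis.

Set Implicit Arguments.
Unset Strict Implicit.
Unset Printing Implicit Defensive.

Import Order.TTheory GRing.Theory Num.Theory.
Import numFieldNormedType.Exports.

Local Open Scope classical_set_scope.
Local Open Scope ring_scope.

Section MeasurableRow.
Context {d} {T : sigmaRingType d}.
Variable n : nat.

Let coors (i : 'I_n) (x : 'rV[T]_n) : T := x ord0 i.

Let rV_set0 : g_sigma_preimage coors set0.
Proof. exact: sigma_algebra0. Qed.

Let rV_setC A : g_sigma_preimage coors A -> g_sigma_preimage coors (~` A).
Proof. exact: sigma_algebraC. Qed.

Let rV_bigcup (F : _^nat) : (forall i, g_sigma_preimage coors (F i)) ->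
  g_sigma_preimage coors (\bigcup_i (F i)).
Proof. exact: sigma_algebra_bigcup. Qed.

(* The product sigma-algebra, as on n.-tuple T. *)
HB.instance Definition _ := @isMeasurable.Build (measure_tuple_display d)
  'rV[T]_n (g_sigma_preimage coors) rV_set0 rV_setC rV_bigcup.

End MeasurableRow.

Lemma measurable_coord d (T : sigmaRingType d) n (i : 'I_n) :
  measurable_fun [set: 'rV[T]_n] (fun x => x ord0 i).
Proof.
move=> _ Y mY; rewrite setTI; apply: sub_sigma_algebra => /=.
rewrite -bigcup_seq/=; exists i => /=; first by rewrite mem_index_enum.
by exists Y => //; rewrite setTI.
Qed.

Lemma measurable_fun_rVP d1 d2 (T1 : measurableType d1)
    (T2 : measurableType d2) n (f : T1 -> 'rV[T2]_n) :
  measurable_fun [set: T1] f <->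
  forall i, measurable_fun [set: T1] (fun t => f t ord0 i).
Proof.
split=> [mf i|mf]; first exact: measurableT_comp (measurable_coord i) mf.
move=> _ A mA; rewrite setTI.
move: A mA; apply: smallest_sub.
  split=> [|A mA|F mF] /=.
  - by rewrite preimage_set0.
  - by rewrite setTD preimage_setC; exact: measurableC.
  - by rewrite preimage_bigcup; exact: bigcupT_measurable.
move=> A; rewrite -bigcup_seq/= => -[i _ [B mB <-]] /=.
by rewrite setTI -[_ @^-1` _]setTI; exact: mf.
Qed.

Section LebesgueRow.
Context (R : realType).

Definition consrV n (p : R * 'rV[R]_n) : 'rV[R]_n.+1 :=
  row_mx (const_mx p.1 : 'rV_1) p.2.

Lemma consrV0 n p : @consrV n p ord0 ord0 = p.1.
Proof. by rewrite /consrV mxE; case: splitP => j; rewrite ?mxE. Qed.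

Lemma consrVS n p (i : 'I_n) : @consrV n p ord0 (lift ord0 i) = p.2 ord0 i.
Proof.
rewrite /consrV mxE; case: splitP => j; first by rewrite ord1.
by rewrite /= /bump/= => -[/val_inj ->].
Qed.

Lemma measurable_consrV n : measurable_fun [set: _] (@consrV n).
Proof.
apply/measurable_fun_rVP => i; case: (unliftP ord0 i) => [j|] ->.
  under eq_fun do rewrite consrVS.
  apply: (@measurableT_comp _ _ _ _ _ _ (fun x : 'rV[R]_n => x ord0 j) _ snd).
    exact: measurable_coord.
  exact: measurable_snd.
by under eq_fun do rewrite consrV0; exact: measurable_fst.
Qed.

Lemma consrV_bij n : bijective (@consrV n).
Proof.
exists (fun x : 'rV[R]_(1 + n) => (lsubmx x ord0 ord0, rsubmx x)).
  by move=> [t x]; rewrite /consrV /= row_mxKl row_mxKr mxE.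
move=> x; rewrite /consrV /= -[RHS](@hsubmxK _ _ 1 n); congr row_mx.
by apply/matrixP => i j; rewrite mxE !ord1.
Qed.

Section leb_step.
Local Open Scope ereal_scope.
Variables (n : nat) (m : {sigma_finite_measure set 'rV[R]_n -> \bar R}).

Definition leb_step : set 'rV[R]_n.+1 -> \bar R :=
  pushforward (lebesgue_measure \x m) (@consrV n).

Let mconsrV (A : set 'rV[R]_n.+1) : measurable A ->
  measurable (@consrV n @^-1` A).
Proof. by move=> mA; rewrite -[X in measurable X]setTI; exact: measurable_consrV. Qed.

Let leb_step0 : leb_step set0 = 0.
Proof. by rewrite /leb_step /pushforward preimage_set0 measure0. Qed.

Let leb_step_ge0 A : 0 <= leb_step A.
Proof. by rewrite /leb_step /pushforward measure_ge0. Qed.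

Let leb_step_sigma_additive : semi_sigma_additive leb_step.
Proof.
move=> F mF tF mUF; rewrite /leb_step /pushforward preimage_bigcup.
apply: measure_semi_sigma_additive.
- by move=> k; exact: mconsrV.
- apply/trivIsetP => /= i j _ _ ij; rewrite -preimage_setI.
  by move/trivIsetP : tF => /(_ _ _ _ _ ij) ->//; rewrite preimage_set0.
- by rewrite -preimage_bigcup; exact: mconsrV.
Qed.

HB.instance Definition _ := isMeasure.Build _ _ _ leb_step
  leb_step0 leb_step_ge0 leb_step_sigma_additive.

Let leb_step_sigma_finite : sigma_finite setT leb_step.
Proof.
have [F FT Foo] : sigma_finite setT (lebesgue_measure \x m).
  have /sigma_finiteP[F [TF ndF Foo]] := sigma_finiteT (@lebesgue_measure R).
  have /sigma_finiteP[G [TG ndG Goo]] := sigma_finiteT m.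
  exists (fun k => F k `*` G k).
    rewrite -setXTT TF TG predeqE => -[x y]; split => [|[k _ []/= ? ?]].
      move=> [/= [k _ Fkx] [l _ Gly]]; exists (maxn k l) => //; split.
        by move: x Fkx; exact/subsetPset/ndF/leq_maxl.
      by move: y Gly; exact/subsetPset/ndG/leq_maxr.
    by split; exists k.
  move=> k; have [? ?] := Foo k; have [? ?] := Goo k.
  split; first exact: measurableX.
  by rewrite product_measure1E// lte_mul_pinfty// ge0_fin_numE.
have [g gK Kg] := consrV_bij n.
have mg : measurable_fun [set: _] g.
  have gE x : g x = (x ord0 ord0, \row_i x ord0 (lift ord0 i)).
    rewrite -{2 3}[x]Kg consrV0; case: (g x) => t y /=; congr pair.
    by apply/rowP => i; rewrite mxE consrVS.
  rewrite (_ : g = fun x => (x ord0 ord0, \row_i x ord0 (lift ord0 i))); last first.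
    exact/funext.
  apply: measurable_fun_pair; first exact: measurable_coord.
  apply/measurable_fun_rVP => i; under eq_fun do rewrite mxE.
  exact: measurable_coord.
exists (fun k => g @^-1` F k).
  by rewrite -preimage_bigcup -FT preimage_setT.
move=> k; have [mFk Fkoo] := Foo k; split.
  by rewrite -[X in measurable X]setTI; exact: mg.
rewrite /leb_step /pushforward -comp_preimage (_ : g \o _ = id)//.
by apply/funext => x /=; rewrite gK.
Qed.

HB.instance Definition _ := Measure_isSigmaFinite.Build _ _ _ leb_step
  leb_step_sigma_finite.

End leb_step.

(* Lebesgue measure on the Borel sets of R^n = R x R^(n-1), by iterated
   products. *)
Fixpoint lebesgue_rV n : {sigma_finite_measure set 'rV[R]_n -> \bar R} :=
  match n with
  | 0 => dirac (0 : 'rV[R]_0)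
  | n'.+1 => leb_step (lebesgue_rV n')
  end.

Lemma lebesgue_rV_box n (a b : 'rV[R]_n) : (forall i, a ord0 i <= b ord0 i)%R ->
  lebesgue_rV n [set x | forall i, (a ord0 i <= x ord0 i <= b ord0 i)%R] =
  (\prod_(i < n) (b ord0 i - a ord0 i))%:E.
Proof.
elim: n a b => [|n IHn] a b ab /=.
  by rewrite diracE big_ord0 mem_set// => -[].
pose a' : 'rV[R]_n := \row_i a ord0 (lift ord0 i).
pose b' : 'rV[R]_n := \row_i b ord0 (lift ord0 i).
have consE : @consrV n @^-1`
    [set x | forall i, (a ord0 i <= x ord0 i <= b ord0 i)%R] = `[a ord0 ord0, b ord0 ord0] `*`
    [set x : 'rV[R]_n | forall i, (a' ord0 i <= x ord0 i <= b' ord0 i)%R].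
  apply/seteqP; split => -[t x] /=.
    move=> H; split=> /=.
      by have := H ord0; rewrite consrV0 in_itv.
    by move=> i; have := H (lift ord0 i); rewrite consrVS !mxE.
  move=> [/= tab H] i; case: (unliftP ord0 i) => [j|] ->.
    by rewrite consrVS; have := H j; rewrite !mxE.
  by rewrite consrV0; move: tab; rewrite in_itv.
rewrite /leb_step /pushforward consE product_measure1E//.
- rewrite IHn => [|i]; last by rewrite !mxE.
  have := lebesgue_measure_itv `[a ord0 ord0, b ord0 ord0] => /= ->.
  rewrite big_ord_recl EFinM; congr (_ * _)%E; last first.
    by congr EFin; apply: eq_bigr => i _; rewrite !mxE.
  rewrite lte_fin; have := ab ord0; rewrite le_eqVlt => /predU1P[->|->//].
  by rewrite ltxx subrr.
- have -> : [set x : 'rV[R]_n | forall i, (a' ord0 i <= x ord0 i <= b' ord0 i)%R] =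
     \bigcap_(i in [set: 'I_n]) ((fun x : 'rV[R]_n => x ord0 i) @^-1`
        `[a' ord0 i, b' ord0 i]).
    apply/seteqP; split => x /= H i; first by move=> _; rewrite /= in_itv/=; exact: H.
    by have := H i I; rewrite /= in_itv.
  apply: fin_bigcap_measurable => // i _.
  by rewrite -[X in measurable X]setTI; exact: measurable_coord.
Qed.

End LebesgueRow.

(* Integer polynomials in the 2n coordinates of (x, x'): variable lshift n k is
   the k-th coordinate of x, variable rshift n k is the k-th one of x'. *)
Section PolynomialLaw.
Context (R : realType) (n : nat).
Implicit Types (p : 'I_n -> mpoly (n + n) int) (x y : 'rV[R]_n).

Definition poly_law p x y : 'rV[R]_n :=
  x + y + \row_j mmap intr (row_mx x y ord0) (p j).

End PolynomialLaw.

(* The Lie algebra of a Lie group structure op on R^n (with neutral element 0)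
   is T_0 R^n = R^n with [x, y] = d/da|_0 Ad(exp(a x)) y, where
   Ad(g) y = d/db|_0 (g * exp(b y) * g^-1).  The formula below is this bracket
   when every line a |-> a x is a one-parameter subgroup, that is, when
   exp : R^n -> R^n is the identity (so that exp(a x)^-1 = (- a) x). *)
Section LieAlgebra.
Context (R : realType) (n : nat).
Variable op : 'rV[R]_n -> 'rV[R]_n -> 'rV[R]_n.

Definition lie_bracket (x y : 'rV[R]_n) : 'rV[R]_n :=
  derive1 (fun a : R =>
    derive1 (fun b : R => op (op (a *: x) (b *: y)) (- a *: x)) 0) 0.

(* [U, V], the linear span of the brackets; bases suffice by bilinearity. *)
Definition lie_bracketv (U V : {vspace 'rV[R]_n}) : {vspace 'rV[R]_n} :=
  <<[seq lie_bracket u v | u <- vbasis U, v <- vbasis V]>>%VS.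

End LieAlgebra.

Definition layer (R : realType) (n : nat) (deg : 'I_n -> nat) (i : nat) :
    {vspace 'rV[R]_n} :=
  <<[seq delta_mx ord0 j | j <- enum 'I_n & deg j == i]>>%VS.

(* A rational Carnot group of step s in fixed exponential coordinates on
   R^n = R^(n_1) x ... x R^(n_s): coordinate j belongs to the block x_(deg j).
   The group is R^n itself, hence connected and simply connected. *)
Record rational_carnot (R : realType) (n s : nat) := RationalCarnot {
  deg : 'I_n -> nat;
  lawp : 'I_n -> mpoly (n + n) int;
  deg_bound : forall j, (1 <= deg j <= s)%N;
  deg_sorted : forall j k : 'I_n, (j <= k)%N -> (deg j <= deg k)%N;
  (* lawp j only involves the coordinates of the earlier blocks *)
  lawp_triangular : forall j (m : multinom (n + n)),
    m \in msupp (lawp j) -> forall k : 'I_n,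
    (0 < m (lshift n k))%N || (0 < m (rshift n k))%N -> (deg k < deg j)%N;
  lawA : associative (@poly_law R n lawp);
  law_exp : forall (x : 'rV[R]_n) (a b : R),
    poly_law lawp (a *: x) (b *: x) = (a + b) *: x;
  stratified : forall i, (1 <= i <= s)%N ->
    lie_bracketv (poly_law lawp) (layer R deg 1) (layer R deg i) =
    layer R deg i.+1
}.

Section CarnotGroup.
Context (R : realType) (n s : nat) (G : rational_carnot R n s).
Implicit Types (x y z g : 'rV[R]_n).

Definition cmul x y : 'rV[R]_n := poly_law (lawp G) x y.

Definition cinv x : 'rV[R]_n := - x.

Lemma cmulA : associative cmul. Proof. exact: lawA. Qed.

Lemma cmul0g : left_id 0 cmul.
Proof.
by move=> x; have := law_exp G x 0 1; rewrite add0r scale1r scale0r.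
Qed.

Lemma cmulg0 : right_id 0 cmul.
Proof.
by move=> x; have := law_exp G x 1 0; rewrite addr0 scale1r scale0r.
Qed.

Lemma cmulVg : left_inverse 0 cinv cmul.
Proof.
by move=> x; have := law_exp G x (-1) 1; rewrite addNr scale1r scale0r scaleN1r.
Qed.

Lemma cmulgV : right_inverse 0 cinv cmul.
Proof.
by move=> x; have := law_exp G x 1 (-1); rewrite subrr scale1r scale0r scaleN1r.
Qed.

Definition layer_dim (i : nat) : nat := #|[set j : 'I_n | deg G j == i]|.

Definition hausdorff_dim : nat :=
  (\sum_(1 <= i < s.+1) i * layer_dim i)%N.

Definition dil (r : R) x : 'rV[R]_n := \row_j (r ^+ deg G j * x ord0 j).

Definition integral_points : set 'rV[R]_n :=
  [set p | forall j, p ord0 j \is a Num.int].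

Section WeightedMetric.
Variable lam : nat -> R.

Definition wnorm x : R :=
  \big[Num.max/0]_(j < n) (`|lam (deg G j) * x ord0 j| `^ (deg G j)%:R^-1).

Definition wdist x y : R := wnorm (cmul (cinv x) y).

Definition unit_ball_volume : R :=
  fine (lebesgue_rV R n [set x | wdist 0 x <= 1]).

Definition solutions (C : R) g (N : nat) : set ('rV[R]_n * nat) :=
  [set pq | [/\ integral_points pq.1, (1 <= pq.2 <= N)%N &
    wdist g (dil pq.2%:R^-1 pq.1) <=
      C * pq.2%:R `^ (- (hausdorff_dim.+1%:R / hausdorff_dim%:R))]].

(* fset_set is set0 on infinite sets; see finite_solutions below. *)
Definition nb_solutions (C : R) g (N : nat) : nat :=
  #|` fset_set (solutions C g N)|.

End WeightedMetric.
End CarnotGroup.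

Lemma le_mmap_norm (R : realType) m (p : mpoly m int) (v : 'I_m -> R) (B : R) :
  (forall i, `|v i| <= B) ->
  `|mmap intr v p| <= mmap (fun c : int => `|c|%:~R) (fun=> B) p.
Proof.
move=> vB; rewrite /mmap; apply: (le_trans (ler_norm_sum _ _ _)).
apply: ler_sum => k _; rewrite normrM -intr_norm ler_wpM2l ?ler0z//.
rewrite /mmap1 normr_prod; apply: ler_prod => i _; rewrite normr_ge0/= normrX.
by rewrite lerXn2r// nnegrE// (le_trans _ (vB i)).
Qed.

Section FiniteSolutions.
Context (R : realType) (n s : nat) (G : rational_carnot R n s).
Variable lam : nat -> R.
Hypothesis lam_gt0 : forall i, (1 <= i <= s)%N -> 0 < lam i.

Lemma wnorm_bounded (r : R) :
  exists B, forall x : 'rV[R]_n, wnorm G lam x <= r -> forall j, `|x ord0 j| <= B.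
Proof.
exists (\sum_(j < n) `|r| ^+ deg G j / lam (deg G j)) => x xr j.
have lamj := lam_gt0 (deg_bound G j).
have /andP[dj _] := deg_bound G j.
rewrite (bigD1 j)//= ler_wpDr//.
  apply: sumr_ge0 => k _; rewrite divr_ge0 ?exprn_ge0//.
  exact/ltW/lam_gt0/deg_bound.
rewrite ler_pdivlMr// mulrC -[lam _ in leLHS]gtr0_norm// -normrM.
have : `|lam (deg G j) * x ord0 j| `^ (deg G j)%:R^-1 <= `|r|.
  by rewrite (le_trans _ (ler_norm r))// (le_trans _ xr)// /wnorm le_bigmax.
move=> /(lerXn2r (deg G j) _ _); rewrite !nnegrE powR_ge0 normr_ge0.
move=> /(_ isT isT).
by rewrite -powR_mulrn ?powR_ge0// -powRrM mulVf ?powRr1// pnatr_eq0 -lt0n.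
Qed.

Lemma cmul_bounded g (B : R) : exists B', forall x : 'rV[R]_n,
  (forall j, `|x ord0 j| <= B) -> forall j, `|cmul G g x ord0 j| <= B'.
Proof.
pose A := \sum_(j < n) `|g ord0 j| + `|B|.
have gA j : `|g ord0 j| <= A.
  rewrite /A (bigD1 j)//= -addrA ler_wpDr//.
  by rewrite addr_ge0// sumr_ge0.
pose P j := mmap (fun c : int => `|c|%:~R) (fun=> A) (lawp G j).
exists (A + A + \sum_(j < n) `|P j|) => x xB j.
have xA k : `|x ord0 k| <= A.
  by rewrite (le_trans (xB k))// (le_trans (ler_norm B))// ler_wpDl// sumr_ge0.
rewrite /cmul /poly_law !mxE (le_trans (ler_normD _ _))// lerD//.
  by rewrite (le_trans (ler_normD _ _))// lerD.
rewrite (bigD1 j)//= ler_wpDr ?sumr_ge0//.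
rewrite (le_trans _ (ler_norm _))//; apply: le_mmap_norm => k.
by rewrite mxE; case: splitP.
Qed.

Lemma finite_solutions (C : R) g N : finite_set (solutions G lam C g N).
Proof.
pose S q : set 'rV[R]_n := [set p | [/\ @integral_points R n p, (0 < q)%N &
  wdist G lam g (dil G q%:R^-1 p) <=
    C * q%:R `^ (- ((hausdorff_dim G).+1%:R / (hausdorff_dim G)%:R))]].
apply: (@sub_finite_set _ _ (\bigcup_(q in `I_N.+1) (fun p => (p, q)) @` S q)).
  move=> [p q] /= [pZ /andP[q1 qN] pq]; exists q => //=.
  by exists p.
apply: bigcup_finite => // q _; apply: finite_image.
rewrite {}/S; set r := C * _.
have [B hB] := wnorm_bounded r; have [B' hB'] := cmul_bounded g B.
pose M := (Num.truncn (\sum_(j < n) q%:R ^+ deg G j * `|B'|)).+1.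
pose F (f : {ffun 'I_n -> 'I_(M + M).+1}) : 'rV[R]_n :=
  \row_j ((f j)%:R - M%:R).
apply: (@sub_finite_set _ _ (F @` setT)); last exact/finite_image/finite_finset.
move=> p [/= pZ q_gt0 pr].
have pM j : `|p ord0 j| <= M%:R.
  set y := dil G q%:R^-1 p in pr.
  have yE : y = cmul G g (cmul G (cinv g) y) by rewrite cmulA cmulgV cmul0g.
  have yB' : `|y ord0 j| <= B' by rewrite yE; apply/hB'/hB.
  have -> : p ord0 j = q%:R ^+ deg G j * y ord0 j.
    by rewrite mxE exprVn mulVKf// expf_neq0// pnatr_eq0 -lt0n.
  apply: (@le_trans _ _ (\sum_(j < n) q%:R ^+ deg G j * `|B'|)); last first.
    exact/ltW/truncnS_gt.
  rewrite (bigD1 j)//= ler_wpDr//.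
    by apply: sumr_ge0 => k _; rewrite mulr_ge0// exprn_ge0.
  rewrite normrM normrX (ger0_norm (ler0n _ q)) ler_wpM2l ?exprn_ge0//.
  by rewrite (le_trans yB')// ler_norm.
have pz j : {z : int | p ord0 j = z%:~R}.
  by exists (Num.floor (p ord0 j)); rewrite floorK.
pose z j := sval (pz j); have zE j : p ord0 j = (z j)%:~R by exact: svalP (pz j).
exists [ffun j => inord (absz (z j + M%:Z))] => //.
apply/rowP => j; rewrite mxE ffunE zE.
have := pM j; rewrite zE -[M%:R]/(M%:Z%:~R) -intr_norm ler_int ler_norml.
move=> /andP[zM Mz].
have zM0 : 0 <= z j + M%:Z by rewrite addrC -[M%:Z]opprK addrC subr_ge0.
rewrite inordK; last by rewrite ltnS -lez_nat gez0_abs// PoszD lerD2r.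
by rewrite -[(absz _)%:R]/((absz _)%:Z%:~R) gez0_abs// -rmorphB/= addrK.
Qed.

End FiniteSolutions.

(* Main.v *)
Require Import Defs.
From HB Require Import structures.
From mathcomp Require Import all_boot all_order all_algebra.
From mathcomp Require Import finmap.
From mathcomp Require Import -(notations) mpoly.
From mathcomp Require Import all_classical all_reals all_analysis.
From mathcomp Require Import measurable_realfun.
From mathcomp Require Import ring lra zify.

Set Implicit Arguments.
Unset Strict Implicit.
Unset Printing Implicit Defensive.

Import Order.TTheory GRing.Theory Num.Theory.
Import numFieldNormedType.Exports.

Local Open Scope classical_set_scope.
Local Open Scope ring_scope.

(* Write [Gamma] for the integral points, [K] for the cell [0, 1)^n and, for each
   q, F_q(g) for the number of p in [Gamma] with d(g, dil q^-1 p) <= C q^(-(Q+1)/Q).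
   The triangle inequality alone forces the group law to be homogeneous: each
   coordinate of (dil t x)(dil t y) is a polynomial in t that is O(t^(deg j)) at
   0 and at infinity.  Hence dilations are automorphisms, and [K] is a fundamental
   domain of [Gamma], which preserves Lebesgue measure.

   Unfolding the sum over [Gamma] gives F_q the mean B C^Q / q on [K].  In the
   integral of F_q F_k, unfold F_q; with d = gcd(q, k), a = q / d, b = k / d, the
   pairs (t, p) that remain are grouped by w = (dil b t)^-1 (dil a p), at most d^Q
   of them for each w, and the number of w in [Gamma] lying in a ball of radius r
   is at most B (r + D)^Q.  The covariance is thus
   O((k^(-7/6) + a^(-7/3)) / q) for k <= q, whose sum over k is O(1 / q); this is
   where Q >= 3 is used.  So the sum of F_q over 2^u <= q < 2^v has variance
   O(v - u), and the dyadic argument of Rademacher and Menshov applied to the blocks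
   2^k <= q < 2^(k+1) gives the almost everywhere error term. *)

(** The exponents of the error term come from three losses. A sum of at most 2^m blocks is cut into
    at most m + 1 dyadic intervals, and Cauchy-Schwarz costs that factor; the m + 1 scales cost it
    again in the integral; summable Markov weights cost (m + 1)^(1 + 2 eps). With 2^m of order log N
    and m of order log log N, the square root is (log N)^(1/2) (log log N)^(3/2 + eps).

    The obstacle is that F_q and F_k are not independent: when gcd(q, k) is large, the grids dil
    q^-1 Gamma and dil k^-1 Gamma share many points. Since the means are exact, an upper bound on
    the correlations is enough, and it needs no lattice point asymptotics: comparing volumes costs
    only an additive D, a bound for the norm on K, in the radius. Dilating by lcm(q, k) makes the
    radius large before D is added, so that relative to the scale a the loss is D / a.

    The counts are invariant under Gamma. This allows the probabilistic argument to run on K, which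
    has measure 1, and the null set found there has only countably many translates. *)

(** * Polynomials bounded by a monomial on the positive reals *)

Section PolynomialGrowth.
Context (R : realType).
Implicit Type p : {poly R}.

(* Compare at large [t] when [m > k] and at small [t] when [m < k]. *)
Lemma monomial_growth (c K : R) (m k : nat) : m != k ->
  (forall t, 0 < t -> `|c| * t ^+ m <= K * t ^+ k) -> c = 0.
Proof.
move=> mk H; apply/eqP; apply: contraT => c0.
have c_gt0 : 0 < `|c| by rewrite normr_gt0.
have K_ge0 : 0 <= K.
  by have := H 1 ltr01; rewrite !expr1n !mulr1; apply: le_trans; exact: ltW.
(* The test point satisfies [u >= 1] and [|c| * u > K]; the bound at [u^-1] (if [m < k]) or at [u]
   (if [k < m]) would give [|c| * u <= K]. *)
pose u := K / `|c| + 1.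
have u1 : 1 <= u by rewrite lerDr divr_ge0// ltW.
have u0 : 0 < u by rewrite (lt_le_trans ltr01).
have Ku : K < `|c| * u by rewrite mulrDr mulrCA divff ?gt_eqF// !mulr1 ltrDl.
suff : `|c| * u <= K by rewrite leNgt Ku.
move: mk; rewrite neq_ltn => /orP[mk|km].
  have := H u^-1 (ltac:(by rewrite invr_gt0)).
  rewrite !exprVn ler_pdivlMr ?exprn_gt0// mulrAC -mulrA -exprB ?(ltnW mk)//; last first.
    by rewrite unitfE gt_eqF.
  apply: le_trans; rewrite ler_wpM2l// ler_eXnr//.
  by rewrite subn_gt0.
have := H u u0; rewrite -ler_pdivrMr ?exprn_gt0// -mulrA -exprB ?(ltnW km)//; last first.
  by rewrite unitfE gt_eqF.
apply: le_trans; rewrite ler_wpM2l// ler_eXnr//.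
by rewrite subn_gt0.
Qed.

(* Induction on the degree: [p.[2 t] - 2 ^+ m * p.[t]] has no term of degree
   [m], and its other coefficients are nonzero multiples of those of [p]. *)
Lemma poly_growth p (K : R) (k : nat) :
  (forall t, 0 < t -> `|p.[t]| <= K * t ^+ k) -> forall t, p.[t] = p`_k * t ^+ k.
Proof.
move=> pK; suff pi i : i != k -> p`_i = 0.
  move=> t; rewrite horner_coef; case: (ltnP k (size p)) => kp.
    rewrite (bigD1 (Ordinal kp))//= big1 ?addr0// => i ik.
    by rewrite pi ?mul0r//; apply: contra_neq ik => ik; exact: val_inj.
  rewrite big1 ?nth_default ?mul0r// => i _.
  by rewrite pi ?mul0r// ltn_eqF// (leq_trans (ltn_ord i)).
move: i; have [n] := ubnP (size p).
elim: n p K pK => // n IH p K pK; rewrite ltnS => sp i ik.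
case: n => [|m] in IH sp.
  by move: sp; rewrite leqn0 size_poly_eq0 => /eqP ->; rewrite coef0.
pose q := p \Po (2%:P * 'X) - (2 ^+ m)%:P * p.
have qE t : q.[t] = p.[2 * t] - 2 ^+ m * p.[t].
  by rewrite /q !hornerE horner_comp !hornerE.
have qi l : q`_l = p`_l * (2 ^+ l - 2 ^+ m).
  rewrite /q coefB coefCM.
  have -> : p \Po (2%:P * 'X) = \poly_(i < size p) (2 ^+ i * p`_i).
    rewrite comp_polyE poly_def; apply: eq_bigr => j _.
    by rewrite exprMn -polyC_exp mul_polyC scalerA mulrC.
  rewrite coef_poly; case: ltnP => lp; first by ring.
  by rewrite nth_default//; ring.
have pm l : (l < m)%N -> l != k -> p`_l = 0.
  move=> lm lk; have /(IH q (K * 2 ^+ k + 2 ^+ m * K)) : forall t, 0 < t ->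
      `|q.[t]| <= (K * 2 ^+ k + 2 ^+ m * K) * t ^+ k.
    move=> t t0; rewrite qE (le_trans (ler_normB _ _))// [leRHS]mulrDl lerD//.
      by rewrite (le_trans (pK _ _)) ?mulr_gt0// exprMn mulrA.
    by rewrite normrM ger0_norm ?exprn_ge0// -mulrA ler_wpM2l ?exprn_ge0// pK.
  move=> /(_ _ l lk); rewrite qi => /(_ _)/eqP; rewrite mulf_eq0 => H.
  have /H /orP[/eqP//|] : (size q < m.+1)%N.
    rewrite ltnS; apply/leq_sizeP => j; rewrite leq_eqVlt => /predU1P[<-|mj].
      by rewrite qi subrr mulr0.
    by rewrite qi nth_default ?mul0r// (leq_trans sp).
  by rewrite subr_eq0 (inj_eq (ieexprIn _ _)) ?ltr0n ?pnatr_eq1// ltn_eqF.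
case: (ltngtP i m) => [im|mi|im]; first exact: pm.
  by rewrite nth_default// (leq_trans sp).
(* Only the terms of degree [m] and [k] are left, so the former is bounded by
   [(K + |p_k|) * t ^+ k], against [monomial_growth]. *)
rewrite {}im in ik *; apply: (@monomial_growth _ (K + `|p`_k|) m k) => // t t0.
have pE : p.[t] = p`_m * t ^+ m + p`_k * t ^+ k \/ p`_m = 0.
  case: (ltngtP m k) => mk; last by rewrite mk eqxx in ik.
  - left; rewrite (@nth_default _ _ _ k) ?mul0r ?addr0 ?(leq_trans sp)//.
    rewrite (@horner_coef_wide _ m.+1)// big_ord_recr/= big1 ?add0r// => j _.
    by rewrite pm ?mul0r// ltn_eqF// (ltn_trans _ mk).
  - left; rewrite (@horner_coef_wide _ m.+1)// big_ord_recr/= addrC; congr (_ + _).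
    rewrite (bigD1 (Ordinal mk))//= big1 ?addr0// => j jk.
    by rewrite pm ?mul0r//; apply: contra_neq jk => jk; exact: val_inj.
case: pE => [pE|->]; last first.
  by rewrite normr0 mul0r mulr_ge0 ?addr_ge0 ?exprn_ge0 ?(ltW t0)//;
    have := pK 1 ltr01; rewrite expr1n mulr1; apply: le_trans.
have -> : `|p`_m| * t ^+ m = `|p.[t] - p`_k * t ^+ k|.
  by rewrite pE addrK normrM [Num.norm (t ^+ m)]ger0_norm// exprn_ge0// ltW.
rewrite (le_trans (ler_normB _ _))// mulrDl lerD ?pK//.
by rewrite normrM [Num.norm (t ^+ k)]ger0_norm// exprn_ge0// ltW.
Qed.

End PolynomialGrowth.

(** * The weighted norm, inverses and dilations *)

Section CarnotNorm.
Context (R : realType) (n s : nat) (G : rational_carnot R n s).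
Variable lam : nat -> R.
Hypothesis lam_gt0 : forall i, (1 <= i <= s)%N -> 0 < lam i.
Implicit Types (x y z g : 'rV[R]_n) (r t : R).

Let lamj_gt0 (j : 'I_n) : 0 < lam (deg G j).
Proof. exact/lam_gt0/deg_bound. Qed.

Lemma deg_gt0 (j : 'I_n) : (0 < deg G j)%N.
Proof. by have /andP[] := deg_bound G j. Qed.

Lemma wnorm_ge0 x : 0 <= wnorm G lam x.
Proof. by rewrite /wnorm; elim/big_ind: _ => // u v u0 _; rewrite le_max u0. Qed.

(** Balls are coordinate boxes, since the power [deg G j] undoes the root in [wnorm]. Volumes and
    norm estimates are read off from this form. *)
Lemma wnorm_leP r x : 0 <= r ->
  reflect (forall j, `|x ord0 j| <= r ^+ deg G j / lam (deg G j)) (wnorm G lam x <= r).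
Proof.
move=> r0.
have E (j : 'I_n) : (`|lam (deg G j) * x ord0 j| `^ (deg G j)%:R^-1 <= r) =
    (`|x ord0 j| <= r ^+ deg G j / lam (deg G j)).
  rewrite ler_pdivlMr// mulrC -[lam _ in RHS]gtr0_norm// -normrM.
  set u := `|_|; have u0 : 0 <= u by exact: normr_ge0.
  pose w := u `^ (deg G j)%:R^-1.
  have wE : w ^+ deg G j = u.
    by rewrite -powR_mulrn ?powR_ge0// -powRrM mulVf ?powRr1// pnatr_eq0 -lt0n deg_gt0.
  by rewrite -/w -[X in _ = (X <= _)]wE ler_pXn2r ?nnegrE ?powR_ge0 ?deg_gt0.
apply: (iffP idP) => [xr j|H].
  by rewrite -E (le_trans _ xr)// /wnorm le_bigmax.
by rewrite /wnorm; apply/bigmax_leP; split=> // j _; rewrite E.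
Qed.

Lemma wnormN x : wnorm G lam (- x) = wnorm G lam x.
Proof. by rewrite /wnorm; apply: eq_bigr => j _; rewrite mxE mulrN normrN. Qed.

Lemma wnorm_dil_le t r x : 0 < t -> 0 <= r ->
  (wnorm G lam (dil G t x) <= t * r) = (wnorm G lam x <= r).
Proof.
move=> t0 r0; have tr0 : 0 <= t * r by rewrite mulr_ge0// ltW.
apply/wnorm_leP/wnorm_leP => // H j; have := H j; rewrite !mxE normrM exprMn.
  by rewrite gtr0_norm ?exprn_gt0// -mulrA ler_pM2l// exprn_gt0.
by rewrite gtr0_norm ?exprn_gt0// -mulrA ler_pM2l// exprn_gt0.
Qed.

Lemma wdistE x y : wdist G lam x y = wnorm G lam (cmul G (- x) y).
Proof. by []. Qed.

Lemma wdist0 x : wdist G lam 0 x = wnorm G lam x.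
Proof. by rewrite wdistE oppr0 cmul0g. Qed.

Lemma cmulK x y : cmul G (- x) (cmul G x y) = y.
Proof. by rewrite cmulA cmulVg cmul0g. Qed.

Lemma cmulVK x y : cmul G x (cmul G (- x) y) = y.
Proof. by rewrite cmulA cmulgV cmul0g. Qed.

Lemma cmul_inj x : injective (cmul G x).
Proof. exact: can_inj (cmulK x). Qed.

Lemma cmulN x y : - cmul G x y = cmul G (- y) (- x).
Proof. by apply: (@cmul_inj (cmul G x y)); rewrite cmulgV -cmulA cmulVK cmulgV. Qed.

Lemma wdistC x y : wdist G lam x y = wdist G lam y x.
Proof. by rewrite !wdistE -wnormN cmulN opprK. Qed.

Lemma dilM r t x : dil G r (dil G t x) = dil G (r * t) x.
Proof. by apply/rowP => j; rewrite !mxE exprMn mulrA. Qed.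

Lemma dil1 x : dil G 1 x = x.
Proof. by apply/rowP => j; rewrite mxE expr1n mul1r. Qed.

Lemma dilN r x : dil G r (- x) = - dil G r x.
Proof. by apply/rowP => j; rewrite !mxE mulrN. Qed.

Lemma dilK r : r != 0 -> cancel (dil G r) (dil G r^-1).
Proof. by move=> r0 x; rewrite dilM mulVf// dil1. Qed.

Lemma dilVK r : r != 0 -> cancel (dil G r^-1) (dil G r).
Proof. by move=> r0 x; rewrite dilM divff// dil1. Qed.

Lemma cmulE x y j : cmul G x y ord0 j =
  x ord0 j + y ord0 j + mmap intr (row_mx x y ord0) (lawp G j).
Proof. by rewrite /cmul /poly_law !mxE. Qed.

Hypothesis wdist_triangle : forall x y z : 'rV[R]_n,
  wdist G lam x z <= wdist G lam x y + wdist G lam y z.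

Lemma wnorm_cmul x y : wnorm G lam (cmul G x y) <= wnorm G lam x + wnorm G lam y.
Proof.
have := wdist_triangle (- x) 0 y.
by rewrite [wdist _ _ _ 0]wdistC !wdist0 wnormN wdistE opprK.
Qed.

(* The triangle inequality bounds the j-th coordinate of
   [cmul (dil t x) (dil t y)], a polynomial in t, by a multiple of t^(deg j)
   both for small and for large t: it is homogeneous. *)
Lemma dil_cmul t x y : 0 < t -> dil G t (cmul G x y) = cmul G (dil G t x) (dil G t y).
Proof.
move=> t_gt0; apply/rowP => j.
(* Substituting [x_k 'X^(deg k)] and [y_k 'X^(deg k)] into [lawp] makes [p] the [j]-th coordinate of
   the dilated product, as a polynomial in the dilation factor. *)
pose v (i : 'I_(n + n)) : {poly R} := match fintype.split i with
  inl k => (x ord0 k)%:P * 'X^(deg G k) | inr k => (y ord0 k)%:P * 'X^(deg G k) end.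
pose p : {poly R} := (x ord0 j + y ord0 j)%:P * 'X^(deg G j) +
  mmap (fun c : int => (c%:~R)%:P) v (lawp G j).
have pE t' : p.[t'] = cmul G (dil G t' x) (dil G t' y) ord0 j.
  rewrite cmulE !mxE /p hornerD !hornerE mulrDl; congr (_ + _).
    by rewrite [in RHS]mulrC [X in _ + X = _]mulrC.
  rewrite /mmap horner_sum; apply: eq_bigr => m _.
  rewrite hornerM hornerC; congr (_ * _); rewrite /mmap1 horner_prod.
  apply: eq_bigr => i _; rewrite horner_exp; congr (_ ^+ _).
  by rewrite mxE /v; case: fintype.split => k; rewrite !mxE !hornerE mulrC.
have W0 : 0 <= wnorm G lam x + wnorm G lam y by rewrite addr_ge0// wnorm_ge0.
have pK t' : 0 < t' -> `|p.[t']| <=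
    (wnorm G lam x + wnorm G lam y) ^+ deg G j / lam (deg G j) * t' ^+ deg G j.
  move=> t0; rewrite pE.
  have : wnorm G lam (cmul G (dil G t' x) (dil G t' y)) <= t' * (wnorm G lam x + wnorm G lam y).
    rewrite (le_trans (wnorm_cmul _ _))// mulrDr lerD//.
      by rewrite wnorm_dil_le// wnorm_ge0.
    by rewrite wnorm_dil_le// wnorm_ge0.
  move=> /(wnorm_leP _ (mulr_ge0 (ltW t0) W0)) /(_ j).
  by rewrite exprMn mulrC mulrA mulrAC [X in _ <= X * _]mulrC.
(* Only the coefficient of degree [deg G j] survives; the value at 1 identifies it with the
   coordinate of [cmul G x y]. *)
have := poly_growth pK t; have := poly_growth pK 1.
by rewrite expr1n mulr1 !pE !dil1 => <- ->; rewrite mxE mulrC.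
Qed.

End CarnotNorm.

(** * The lattice of integral points and its unit cell *)

Section IntegerLattice.
Context (R : realType) (n s : nat) (G : rational_carnot R n s).
Implicit Types x y z g p t : 'rV[R]_n.

Local Notation Gamma := (@integral_points R n).

(** Sortedness of the degrees turns triangularity by blocks into triangularity by index, the form
    needed for inductions on coordinates. *)
Lemma lawp_eq x y x' y' (j : 'I_n) :
  (forall k : 'I_n, (k < j)%N -> x ord0 k = x' ord0 k) ->
  (forall k : 'I_n, (k < j)%N -> y ord0 k = y' ord0 k) ->
  mmap intr (row_mx x y ord0) (lawp G j) = mmap intr (row_mx x' y' ord0) (lawp G j).
Proof.
move=> xx' yy'; rewrite /mmap big_seq [RHS]big_seq; apply: eq_bigr => m mP.
congr (_ * _); rewrite /mmap1; apply: eq_bigr => i _.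
have [->|mi] := posnP (m i); first by rewrite !expr0.
have H k : ((0 < m (lshift n k)) || (0 < m (rshift n k)))%N -> (k < j)%N.
  move=> /(lawp_triangular mP); rewrite !ltnNge; apply: contra; exact: deg_sorted.
congr (_ ^+ _); rewrite !mxE; case: fintype.splitP => k ik.
  by apply/xx'/H; rewrite (_ : lshift n k = i) ?mi//; apply: val_inj.
by apply/yy'/H; rewrite (_ : rshift n k = i) ?mi ?orbT//; apply: val_inj.
Qed.

Lemma lawp0g x j : mmap intr (row_mx 0 x ord0) (lawp G j) = 0.
Proof.
have := congr1 (fun y : 'rV[R]_n => y ord0 j) (cmul0g G x).
by rewrite cmulE mxE add0r => /(canRL (addKr _)); rewrite addNr.
Qed.

Lemma integral_points0 : Gamma 0.
Proof. by move=> j; rewrite mxE rpred0. Qed.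

Lemma integral_pointsN p : Gamma p -> Gamma (- p).
Proof. by move=> pZ j; rewrite mxE rpredN. Qed.

Lemma integral_points_cmul p p' : Gamma p -> Gamma p' -> Gamma (cmul G p p').
Proof.
move=> pZ pZ' j; rewrite cmulE !rpredD//.
rewrite /mmap rpred_sum// => m _; rewrite rpredM ?rpred_int//.
rewrite /mmap1 rpred_prod// => i _; rewrite rpredX// mxE.
by case: fintype.split.
Qed.

Lemma integral_points_dil (q : nat) p : Gamma p -> Gamma (dil G q%:R p).
Proof. by move=> pZ j; rewrite mxE rpredM// rpredX// rpred_nat. Qed.

Definition unit_cell : set 'rV[R]_n := [set x | forall j, 0 <= x ord0 j < 1].

(** The coordinates are reduced one at a time: changing [p] at index [k] by an integer translates
    coordinate [k] of the product and leaves the earlier ones alone. *)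
Lemma unit_cell_cover x : exists2 p, Gamma p & unit_cell (cmul G p x).
Proof.
suff H k : (k <= n)%N -> exists2 p, Gamma p &
    forall j : 'I_n, (j < k)%N -> 0 <= cmul G p x ord0 j < 1.
  by have [p pZ pK] := H n (leqnn n); exists p => // j; exact: pK.
elim: k => [|k IH] kn.
  by exists 0 => //; exact: integral_points0.
have [p pZ pK] := IH (ltnW kn); pose k' := Ordinal kn.
pose a : R := (Num.floor (cmul G p x ord0 k'))%:~R.
exists (p - a *: delta_mx ord0 k') => [j|j].
  rewrite !mxE rpredB// rpredM ?rpred_int//.
  by case: eqP => _; case: eqP => _ //; rewrite ?rpred1 ?rpred0.
rewrite ltnS leq_eqVlt => /predU1P[jk|jk].
  have -> : j = k' by exact: val_inj.
  have -> : cmul G (p - a *: delta_mx ord0 k') x ord0 k' = cmul G p x ord0 k' - a.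
    rewrite !cmulE (@lawp_eq _ x p x)//; last first.
      by move=> l lk; rewrite !mxE (_ : (l == k') = false) ?andbF ?mulr0 ?subr0//; apply/eqP => E; rewrite E ltnn in lk.
    by rewrite !mxE !eqxx/=; ring.
  by rewrite subr_ge0 /a floor_le_tmp// ltrBlDl -intrD1 floorD1_gt.
rewrite (_ : cmul _ _ _ _ _ = cmul G p x ord0 j) ?pK// !cmulE.
have pE (l : 'I_n) : (l < k)%N -> (p - a *: delta_mx ord0 k') ord0 l = p ord0 l.
  by move=> lk; rewrite !mxE (_ : (l == k') = false) ?andbF ?mulr0 ?subr0//; apply/eqP => E; rewrite E ltnn in lk.
by rewrite (@lawp_eq _ x p x)// ?pE// => l lj; rewrite pE// (ltn_trans lj).
Qed.

(** Once the earlier coordinates of [p] vanish, the law adds at index [j], and an integer that is a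
    difference of two numbers in [0, 1) is 0. *)
Lemma unit_cell_fundamental x p :
  Gamma p -> unit_cell x -> unit_cell (cmul G p x) -> p = 0.
Proof.
move=> pZ xK pxK; apply/rowP => j; rewrite mxE.
have [m] := ubnP (val j); elim: m j => // m IH j; rewrite ltnS => jm.
have E : cmul G p x ord0 j = p ord0 j + x ord0 j.
  rewrite cmulE (@lawp_eq _ _ 0 x) ?lawp0g ?addr0// => k kj.
  by rewrite IH ?mxE// (leq_trans kj).
have := pxK j; rewrite E; have := xK j => /andP[x0 x1] /andP[px0 px1].
have : `|p ord0 j| < 1 by rewrite ltr_norml; apply/andP; split; lra.
have /intrP[z ->] := pZ j; rewrite -intr_norm ltrz1 => z1.
by have /eqP -> : z == 0 by rewrite -normr_eq0; lia.
Qed.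

Lemma unit_cell_uniq x p p' : Gamma p -> Gamma p' ->
  unit_cell (cmul G p x) -> unit_cell (cmul G p' x) -> p = p'.
Proof.
move=> pZ pZ' pK pK'; have := @unit_cell_fundamental (cmul G p' x) (cmul G p (- p')).
rewrite -cmulA cmulK => /(_ (integral_points_cmul pZ (integral_pointsN pZ')) pK' pK).
by move=> /(congr1 (fun y => cmul G y p')); rewrite -cmulA cmulVg cmulg0 cmul0g.
Qed.

Lemma hausdorff_dimE : hausdorff_dim G = (\sum_j deg G j)%N.
Proof.
rewrite /hausdorff_dim big_add1 /= big_mkord.
have degs (j : 'I_n) : ((deg G j).-1 < s)%N.
  by have := deg_bound G j; case: (deg G j).
rewrite [RHS](partition_big (fun j => Ordinal (degs j)) xpredT)//=.
apply: eq_bigr => i _; rewrite /layer_dim -sum1_card big_distrr/=.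
rewrite (eq_bigl (fun j => Ordinal (degs j) == i)) => [|j]; last first.
  rewrite -val_eqE/= (_ : (j \in _) = (deg G j == i.+1)).
    by have := deg_gt0 G j; case: (deg G j).
  by apply/idP/idP; rewrite in_setE.
apply: eq_bigr => j /eqP <-/=; rewrite muln1.
by have := deg_gt0 G j; case: (deg G j).
Qed.

(** The integral points of the cell dilated by [q], which represent the cosets [(dil q Gamma) t] in
    Gamma. The bound [q ^ Q] merely gives all coordinates a common finite type; the family imposes
    the true ranges. *)
Definition lattice_reps (q : nat) : seq 'rV[R]_n :=
  [seq \row_j (val (f j))%:R | f : {ffun 'I_n -> 'I_(q ^ hausdorff_dim G)} in
     family (fun j => [pred i : 'I_(q ^ hausdorff_dim G) | (i < q ^ deg G j)%N])].

Lemma deg_leq_dim (j : 'I_n) : (deg G j <= hausdorff_dim G)%N.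
Proof. by rewrite hausdorff_dimE (bigD1 j)//= leq_addr. Qed.

Lemma size_lattice_reps q : (0 < q)%N -> size (lattice_reps q) = (q ^ hausdorff_dim G)%N.
Proof.
move=> q0; rewrite size_map -cardE card_family.
rewrite [RHS](_ : _ = \prod_j q ^ deg G j)%N; last by rewrite hausdorff_dimE expn_sum.
rewrite foldrE big_map big_enum/=; apply: eq_bigr => j _.
rewrite -[RHS]card_ord -[RHS]sum1_card -sum1_card.
rewrite [RHS](big_ord_widen _ (fun=> 1%N) (leq_pexp2l q0 (deg_leq_dim j))).
by apply: eq_bigl.
Qed.

Lemma lattice_reps_uniq q : uniq (lattice_reps q).
Proof.
rewrite map_inj_uniq ?enum_uniq// => f f' /rowP ff'; apply/ffunP => j.
by have := ff' j; rewrite !mxE => /(@mulrIn R _ (@oner_neq0 R)) /val_inj.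
Qed.

Lemma mem_lattice_reps q t : (0 < q)%N ->
  t \in lattice_reps q <-> Gamma t /\ unit_cell (dil G q%:R^-1 t).
Proof.
move=> q0; have qR (j : 'I_n) : 0 < (q%:R : R) ^+ deg G j by rewrite exprn_gt0// ltr0n.
rewrite /lattice_reps; split=> [/mapP[f]|[tZ tK]].
  rewrite mem_enum => /familyP fP ->; split=> j; rewrite !mxE; first exact: rpred_nat.
  have := fP j; rewrite inE => fj.
  by rewrite exprVn mulr_ge0 ?invr_ge0 ?(ltW (qR j))//= ltr_pdivrMl// mulr1 -natrX ltr_nat.
have tj j : {m : nat | t ord0 j = m%:R & (m < q ^ deg G j)%N}.
  have /andP[] := tK j; rewrite mxE exprVn pmulr_rge0 ?invr_gt0// => t0.
  rewrite ltr_pdivrMl// mulr1 => tq.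
  have /natrP/cid[m tm] : t ord0 j \is a Num.nat by rewrite natrEint tZ t0.
  by exists m => //; rewrite -(ltr_nat R) natrX -tm.
pose m j := s2val (tj j).
have mq j : (m j < q ^ hausdorff_dim G)%N.
  exact: leq_trans (s2valP' (tj j)) (leq_pexp2l q0 (deg_leq_dim j)).
apply/mapP; exists [ffun j => Ordinal (mq j)].
  by rewrite mem_enum; apply/familyP => j; rewrite ffunE inE/=; exact: (s2valP' (tj j)).
by apply/rowP => j; rewrite !mxE ffunE/=; exact: (s2valP (tj j)).
Qed.

End IntegerLattice.

(** * Invariance of Lebesgue measure under triangular shifts and left translations *)

Section TriangularShift.
Context (R : realType).
Local Open Scope ereal_scope.

Lemma lebesgue_measure_shift (c : R) (A : set R) : measurable A ->
  lebesgue_measure [set t | A (t + c)%R] = lebesgue_measure A.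
Proof.
move=> mA.
rewrite -[LHS]/(pushforward (@lebesgue_measure R) ((fun t => t + c)%R : _ -> measurableTypeR R) A).
apply/esym/lebesgue_measure_unique => //= [|mc _ [[a b] _ <-]].
  by apply: measurable_funD => //; exact: measurable_cst.
rewrite /pushforward (_ : _ @^-1` _ = `]a - c, b - c]%classic)%R; last first.
  by apply/seteqP; split => t/=; rewrite !in_itv/= ltrBlDr lerBrDr.
rewrite !lebesgue_measure_itv/= !lte_fin ltrD2r; case: ifP => // _.
by rewrite -!EFinB; congr EFin; ring.
Qed.

Lemma lebesgue_integral_shift (c : R) (f : R -> \bar R) :
  measurable_fun setT f -> (forall t, 0 <= f t) ->
  \int[lebesgue_measure]_t f (t + c)%R = \int[lebesgue_measure]_t f t.
Proof.
move=> mf f0.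
have mc : measurable_fun [set: R] (fun t : R => t + c)%R.
  by apply: measurable_funD => //; exact: measurable_cst.
rewrite -[RHS](_ : \int[pushforward lebesgue_measure
    ((fun t => t + c)%R : _ -> measurableTypeR R)]_t f t = _).
  by rewrite ge0_integral_pushforward.
by apply: eq_measure_integral => A mA _; exact: lebesgue_measure_shift.
Qed.

(** Fubini replaces a Jacobian: the first coordinate is translated by a constant, and for each value
    of it the other coordinates undergo a triangular shift in one dimension less. *)
Lemma lebesgue_rV_shift n (f : 'rV[R]_n -> 'rV[R]_n) :
  measurable_fun setT f ->
  (forall (x y : 'rV[R]_n) (j : 'I_n),
    (forall k : 'I_n, (k < j)%N -> x ord0 k = y ord0 k) -> f x ord0 j = f y ord0 j) ->
  forall A : set 'rV[R]_n, measurable A ->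
  lebesgue_rV R n [set x | A (x + f x)%R] = lebesgue_rV R n A.
Proof.
elim: n f => [|n IH] f mf tf A mA.
  by congr (lebesgue_rV R 0 _); apply/seteqP; split => x; rewrite /= !thinmx0.
(* No index precedes the first one, so [f] is constant there. *)
pose c := f 0%R ord0 ord0.
have fc x : f x ord0 ord0 = c by apply: tf.
pose F t (x : 'rV[R]_n) : 'rV[R]_n := \row_j f (consrV (t, x)) ord0 (lift ord0 j).
have mconsrVA (B : set 'rV[R]_n.+1) : measurable B -> measurable (@consrV R n @^-1` B).
  by move=> mB; rewrite -[X in measurable X]setTI; exact: measurable_consrV.
have mF t : measurable_fun setT (F t).
  apply/measurable_fun_rVP => i; under eq_fun do rewrite mxE.
  apply: (@measurableT_comp _ _ _ _ _ _ (fun y : 'rV[R]_n.+1 => y ord0 (lift ord0 i))).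
    exact: measurable_coord.
  apply: measurableT_comp => //; apply: measurableT_comp; first exact: measurable_consrV.
  exact: measurable_fun_pair.
pose phi t := lebesgue_rV R n (xsection (@consrV R n @^-1` A) t).
have mphi : measurable_fun setT phi by apply: measurable_fun_xsection; exact: mconsrVA.
rewrite /= /leb_step /pushforward /product_measure1.
rewrite -[RHS](lebesgue_integral_shift c mphi) => [|t]; last exact: measure_ge0.
apply: eq_integral => t _ /=.
have mAt : measurable (xsection (@consrV R n @^-1` A) (t + c)%R).
  by apply: measurable_xsection; exact: mconsrVA.
rewrite /phi -[RHS](IH (F t)) //; last first.
  move=> x y j xy; rewrite !mxE; apply: tf => k.
  case: (unliftP ord0 k) => [k'|] ->; last by rewrite !consrV0.
  by rewrite !consrVS => kj; apply: xy; move: kj; rewrite /= /bump.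
rewrite (_ : xsection _ t = [set x | xsection (@consrV R n @^-1` A) (t + c)%R (x + F t x)%R])//.
rewrite predeqE => x.
rewrite /xsection /mkset !in_setE /preimage /mkset.
rewrite (_ : consrV (t, x) + _ = consrV ((t + c)%R, (x + F t x)%R))%R//.
by apply/rowP => j; rewrite mxE; case: (unliftP ord0 j) => [k|] ->;
    rewrite ?consrV0 ?fc// !consrVS !mxE.
Qed.

Lemma lebesgue_rV_integral_shift n (f : 'rV[R]_n -> 'rV[R]_n) (h : 'rV[R]_n -> \bar R) :
  measurable_fun setT f ->
  (forall (x y : 'rV[R]_n) (j : 'I_n),
    (forall k : 'I_n, (k < j)%N -> x ord0 k = y ord0 k) -> f x ord0 j = f y ord0 j) ->
  measurable_fun setT h -> (forall x, 0 <= h x) ->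
  \int[lebesgue_rV R n]_x h (x + f x)%R = \int[lebesgue_rV R n]_x h x.
Proof.
move=> mf tf mh h0.
have mc : measurable_fun [set: 'rV[R]_n] (fun x => x + f x)%R.
  apply/measurable_fun_rVP => i; under eq_fun do rewrite mxE.
  apply: measurable_funD; first exact: measurable_coord.
  by move/measurable_fun_rVP : mf; exact.
rewrite -[RHS](_ : \int[pushforward (lebesgue_rV R n) (fun x => x + f x)%R]_x h x = _).
  by rewrite ge0_integral_pushforward.
by apply: eq_measure_integral => A mA _; exact: lebesgue_rV_shift.
Qed.

End TriangularShift.

Section HaarMeasure.
Context (R : realType) (n s : nat) (G : rational_carnot R n s).
Implicit Types x y z g p : 'rV[R]_n.
Local Open Scope ereal_scope.

Local Notation leb := (lebesgue_rV R n).

(** Left translation by [g] moves coordinate [j] by an amount that depends only on earlier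
    coordinates of [x], so it is a triangular shift. *)
Let shift g x : 'rV[R]_n :=
  \row_j (g ord0 j + mmap intr (row_mx g x ord0) (lawp G j))%R.

Let cmul_shift g x : cmul G g x = (x + shift g x)%R.
Proof. by apply/rowP => j; rewrite cmulE !mxE; ring. Qed.

Let measurable_shift g : measurable_fun setT (shift g).
Proof.
apply/measurable_fun_rVP => j; under eq_fun do rewrite mxE.
apply: measurable_funD; first exact: measurable_cst.
apply: measurable_sum => m; apply: measurable_funM; first exact: measurable_cst.
rewrite /mmap1; apply: measurable_prod => i _; apply: measurable_funX.
have := split_ordP i => -[k ->|k ->].
  by under eq_fun do rewrite row_mxEl; exact: measurable_cst.
by under eq_fun do rewrite row_mxEr; exact: measurable_coord.
Qed.

Let shift_triangular g x y (j : 'I_n) :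
  (forall k : 'I_n, (k < j)%N -> x ord0 k = y ord0 k) -> shift g x ord0 j = shift g y ord0 j.
Proof. by move=> xy; rewrite !mxE (@lawp_eq _ _ _ _ g x g y). Qed.

Lemma measurable_cmul g : measurable_fun setT (cmul G g).
Proof.
rewrite (_ : cmul G g = fun x => (x + shift g x)%R); last exact/funext/cmul_shift.
apply/measurable_fun_rVP => i; under eq_fun do rewrite mxE.
apply: measurable_funD; first exact: measurable_coord.
by have /measurable_fun_rVP := measurable_shift g; exact.
Qed.

Lemma measurable_cmul_preimage g (A : set 'rV[R]_n) : measurable A ->
  measurable [set x | A (cmul G g x)].
Proof. by move=> mA; rewrite -[X in measurable X]setTI; exact: measurable_cmul. Qed.

Lemma lebesgue_cmul g (A : set 'rV[R]_n) : measurable A ->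
  leb [set x | A (cmul G g x)] = leb A.
Proof.
move=> mA; rewrite -[RHS](lebesgue_rV_shift (measurable_shift g))//.
  by congr (leb _); apply/seteqP; split => x/=; rewrite cmul_shift.
exact: shift_triangular.
Qed.

Lemma integral_cmul g (h : 'rV[R]_n -> \bar R) :
  measurable_fun setT h -> (forall x, 0 <= h x) ->
  \int[leb]_x h (cmul G g x) = \int[leb]_x h x.
Proof.
move=> mh h0; rewrite -[RHS](lebesgue_rV_integral_shift (measurable_shift g))//.
  by apply: eq_integral => x _; rewrite cmul_shift.
exact: shift_triangular.
Qed.

End HaarMeasure.

(** * Sums over countable sets and their integrals *)

Section ExtendedSums.
Context (R : realType).
Local Open Scope ereal_scope.

Lemma sume_const_seq (T : Type) (s : seq T) (c : \bar R) : 0 <= c ->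
  \sum_(i <- s) c = (size s)%:R%:E * c.
Proof.
move=> c0; elim: s => [|x s IH]; first by rewrite big_nil mul0e.
by rewrite big_cons IH /= -natr1 EFinD ge0_muleDl ?lee_fin// mul1e addeC.
Qed.

Lemma esum_const_le (T : choiceType) (A : set T) (s : seq T) (c : \bar R) :
  0 <= c -> A `<=` [set` s] -> \esum_(i in A) c <= (size s)%:R%:E * c.
Proof.
move=> c0 As; apply: ge_ereal_sup => _ [X [finX XA]] <-.
rewrite fsbig_finite//= sume_const_seq// lee_wpmul2r// lee_fin ler_nat.
apply: uniq_leq_size => [|x]; first exact: fset_uniq.
by rewrite in_fset_set// inE => /XA/As.
Qed.

Lemma esum_seq (T : choiceType) (s : seq T) (a : T -> \bar R) : uniq s ->
  (forall i, 0 <= a i) -> \esum_(i in [set` s]) a i = \sum_(i <- s) a i.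
Proof.
move=> us a0; rewrite esum_fset; [|exact: finite_seq|by move=> *; exact: a0].
by rewrite -fsbig_seq.
Qed.

Lemma esum_unique (T : choiceType) (A : set T) (a : T -> \bar R) i :
  A i -> (forall j, A j -> j <> i -> a j = 0) -> 0 <= a i -> \esum_(j in A) a j = a i.
Proof.
move=> Ai a0 ai0; rewrite -[RHS](esum_set1 ai0) esum_mkcond [RHS]esum_mkcond.
apply: eq_esum => j _; case: ifPn => [|]; rewrite ?(inE, notin_setE) => Aj.
  case: ifPn => //; rewrite notin_setE => /= ji.
  by rewrite a0.
by case: ifPn => //; rewrite inE => ji; rewrite ji in Aj.
Qed.

(** The enumeration is chosen before the summand, so that a single one serves every point of an
    integral and [esum] becomes a series for monotone convergence. Option values cover the case of
    an empty type. *)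
Lemma esum_countable (T : choiceType) (A : set T) : countable A ->
  exists (e : nat -> option T) (B : pred nat),
  forall a : T -> \bar R, (forall i, 0 <= a i) ->
  \esum_(i in A) a i = \sum_(k <oo | B k) oapp a 0 (e k) /\
  forall k, B k -> if e k is Some i then A i else False.
Proof.
elim/choicePpointed: T => T in A *.
  move=> _; exists (fun=> None), xpred0 => a a0.
  rewrite (_ : A = set0) ?esum_set0 ?eseries_pred0//.
  by apply/seteqP; split=> x; have := no x.
move=> /countable_bijP[B]; rewrite card_eq_sym => /card_set_bijP[e eB].
exists (Some \o e), (fun k => k \in B) => a a0; split=> [|k]; last first.
  by rewrite inE => Bk; have [+ _ _] := eB; exact.
rewrite nneseries_esum => [|k _]; last exact: a0.
rewrite (reindex_esum B A e)//=; congr esum.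
by apply/seteqP; split => k /=; rewrite inE.
Qed.

Section IntegralEsum.
Context d (X : measurableType d) (mu : {measure set X -> \bar R}) (D : set X).
Context (T : choiceType) (A : set T) (f : T -> X -> \bar R).
Hypothesis mD : measurable D.
Hypothesis cA : countable A.
Hypothesis mf : forall i, A i -> measurable_fun D (f i).
Hypothesis f0 : forall i x, 0 <= f i x.

Lemma measurable_esum : measurable_fun D (fun x => \esum_(i in A) f i x).
Proof.
have [e [B H]] := esum_countable cA.
under eq_fun do rewrite (H (f ^~ _) (fun=> f0 _ _)).1.
apply: ge0_emeasurable_sum => [k x Dx|k Bk]; first by case: (e k) => /=.
have [_ /(_ k Bk)] := H (fun=> 0) (fun=> lexx _).
by case: (e k) => //= i Ai; exact: mf.
Qed.

Lemma integral_esum :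
  \int[mu]_(x in D) (\esum_(i in A) f i x) = \esum_(i in A) \int[mu]_(x in D) f i x.
Proof.
have [e [B H]] := esum_countable cA.
under eq_integral do rewrite (H (f ^~ _) (fun=> f0 _ _)).1 eseries_mkcond.
have i0 i : 0 <= \int[mu]_(x in D) f i x by exact: integral_ge0.
rewrite (H (fun i => \int[mu]_(x in D) f i x) i0).1.
rewrite [RHS]eseries_mkcond integral_nneseries//=; last 2 first.
- move=> k; have [Bk|//] := boolP (B k); have [_ /(_ k Bk)] := H (fun=> 0) (fun=> lexx _).
  by case: (e k) => //= i Ai; exact: mf.
- by move=> k x _; case: ifPn => // _; case: (e k) => /=.
apply: eq_eseriesr => k _; have [Bk|_] := boolP (B k); last by rewrite integral0.
by case: (e k) => //=; rewrite integral0.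
Qed.

End IntegralEsum.
End ExtendedSums.

(** * Volumes of boxes and balls, and unfolding over the lattice *)

Section Boxes.
Context (R : realType).
Local Open Scope ereal_scope.

Lemma measurable_rV_setX n (I : 'I_n -> set R) : (forall i, measurable (I i)) ->
  measurable [set x : 'rV[R]_n | forall i, I i (x ord0 i)].
Proof.
move=> mI; rewrite (_ : [set x | _] =
    \bigcap_(i in [set: 'I_n]) ((fun x : 'rV[R]_n => x ord0 i) @^-1` I i)); last first.
  by apply/seteqP; split => x H i => [_|]; exact: H.
apply: fin_bigcap_measurable => // i _.
by rewrite -[X in measurable X]setTI; exact: measurable_coord.
Qed.

Lemma lebesgue_rV_setX n (I : 'I_n -> set R) : (forall i, measurable (I i)) ->
  lebesgue_rV R n [set x | forall i, I i (x ord0 i)] = \prod_(i < n) lebesgue_measure (I i).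
Proof.
elim: n I => [|n IH] I mI.
  by rewrite /= diracE big_ord0 mem_set => [|[]].
rewrite /= /leb_step /pushforward.
rewrite (_ : _ @^-1` _ = I ord0 `*`
    [set x : 'rV[R]_n | forall i : 'I_n, I (lift ord0 i) (x ord0 i)]).
  rewrite product_measure1E; [|exact: mI|by apply: (@measurable_rV_setX n (fun i => I (lift ord0 i)))].
  by rewrite big_ord_recl; congr (_ * _); exact: (IH (fun i => I (lift ord0 i))).
apply/seteqP; split => -[t x] /= H.
  by split=> [|i]; [have := H ord0; rewrite consrV0|have := H (lift ord0 i); rewrite consrVS].
move=> i; case: (unliftP ord0 i) => [j|] ->; first by rewrite consrVS; exact: H.2.
by rewrite consrV0; exact: H.1.
Qed.

End Boxes.

Section Balls.
Context (R : realType) (n s : nat) (G : rational_carnot R n s).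
Variable lam : nat -> R.
Hypothesis lam_gt0 : forall i, (1 <= i <= s)%N -> 0 < lam i.
Local Open Scope ereal_scope.
Implicit Types x y z g p t u : 'rV[R]_n.

Local Notation leb := (lebesgue_rV R n).
Local Notation Gamma := (@integral_points R n).
Local Notation K := (@unit_cell R n).
Local Notation Q := (hausdorff_dim G).
Local Notation B := (unit_ball_volume G lam).

Lemma measurable_unit_cell : measurable K.
Proof.
rewrite (_ : K = [set x | forall i, `[0, 1[%classic (x ord0 i)])%R; last first.
  by apply/seteqP; split => x H i; have := H i; rewrite /= in_itv.
by apply: (@measurable_rV_setX R n (fun=> `[0, 1[%classic)%R) => i; exact: measurable_itv.
Qed.

Lemma lebesgue_unit_cell : leb K = 1.
Proof.
rewrite (_ : K = [set x | forall i, `[0, 1[%classic (x ord0 i)])%R; last first.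
  by apply/seteqP; split => x H i; have := H i; rewrite /= in_itv.
rewrite (@lebesgue_rV_setX R n (fun=> `[0, 1[%classic)%R)// big1// => i _.
by rewrite lebesgue_measure_itv/= lte_fin ltr01 -EFinB subr0.
Qed.

Let ballE r : (0 <= r)%R -> [set x | (wnorm G lam x <= r)%R] =
  [set x | forall i, ((\row_j (- (r ^+ deg G j / lam (deg G j)))) ord0 i <= x ord0 i <=
    (\row_j (r ^+ deg G j / lam (deg G j))) ord0 i)%R].
Proof.
move=> r0; apply/seteqP; split => x /=.
  by move=> /(wnorm_leP G lam_gt0 _ r0) H i; rewrite !mxE -ler_norml.
by move=> H; apply/(wnorm_leP G lam_gt0 _ r0) => i; have := H i; rewrite !mxE -ler_norml.
Qed.

Lemma measurable_wnorm_ball r : measurable [set x | (wnorm G lam x <= r)%R].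
Proof.
have [r0|r0] := leP 0%R r; last first.
  rewrite [X in measurable X](_ : _ = set0)//; apply/seteqP; split => x //=.
  by move=> /(le_trans (wnorm_ge0 G lam x)); rewrite leNgt r0.
pose I (i : 'I_n) : set R := (`[(\row_j (- (r ^+ deg G j / lam (deg G j)))) ord0 i,
      (\row_j (r ^+ deg G j / lam (deg G j))) ord0 i]%classic)%R.
rewrite ballE// [X in measurable X](_ : _ = [set x : 'rV[R]_n | forall i, I i (x ord0 i)]).
  by apply: measurable_rV_setX => i; exact: measurable_itv.
by apply/seteqP; split => x H i; have := H i; rewrite /I /= in_itv.
Qed.

Let lebesgue_wnorm_ball0 r : (0 <= r)%R -> leb [set x | (wnorm G lam x <= r)%R] =
  (r ^+ Q * \prod_(j < n) (2 / lam (deg G j)))%:E.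
Proof.
move=> r0; have lam0 (i : 'I_n) : (0 < lam (deg G i))%R by exact/lam_gt0/deg_bound.
rewrite ballE// lebesgue_rV_box => [|i].
  rewrite hausdorff_dimE -prodrXr -big_split/=; congr EFin; apply: eq_bigr => i _.
  by rewrite !mxE; ring.
by rewrite !mxE ge0_cp// divr_ge0 ?exprn_ge0// ltW.
Qed.

Lemma unit_ball_volumeE : B = (\prod_(j < n) (2 / lam (deg G j)))%R.
Proof.
rewrite /unit_ball_volume (_ : [set x | _] = [set x | (wnorm G lam x <= 1)%R]).
  by rewrite lebesgue_wnorm_ball0// expr1n mul1r.
by apply/seteqP; split => x /=; rewrite wdist0.
Qed.

Lemma unit_ball_volume_gt0 : (0 < B)%R.
Proof.
rewrite unit_ball_volumeE prodr_gt0// => j _; rewrite divr_gt0//.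
exact/lam_gt0/deg_bound.
Qed.

Lemma lebesgue_wnorm_ball r : (0 <= r)%R ->
  leb [set x | (wnorm G lam x <= r)%R] = (B * r ^+ Q)%:E.
Proof. by move=> r0; rewrite lebesgue_wnorm_ball0// unit_ball_volumeE mulrC. Qed.

Lemma countable_integral_points : countable Gamma.
Proof.
have -> : Gamma = (fun z : 'rV[int]_n => map_mx intr z) @` setT.
  apply/seteqP; split => [p pZ|p [z _ <-] j]; last by rewrite mxE rpred_int.
  exists (\row_j Num.floor (p ord0 j)) => //; apply/rowP => j.
  by rewrite !mxE floorK.
exact: (sub_countable (card_image_le _ _)).
Qed.

(** Translating each integral by [p] moves the restriction to [K] into the factor
    [\1_K (cmul G (- p) x)]; the sum of these factors over the lattice is 1. *)
Lemma integral_unfold (phi : 'rV[R]_n -> \bar R) :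
  measurable_fun setT phi -> (forall x, 0 <= phi x) ->
  \int[leb]_(x in K) (\esum_(p in Gamma) phi (cmul G p x)) = \int[leb]_x phi x.
Proof.
move=> mphi phi0; have mK := measurable_unit_cell.
have mphip p : measurable_fun setT (fun x => phi (cmul G p x)).
  exact: measurableT_comp mphi (measurable_cmul G p).
have m1p p : measurable_fun setT (fun x => (\1_K (cmul G p x))%:E : \bar R).
  apply/measurable_EFinP.
  have m1 : measurable_fun setT (\1_K : 'rV[R]_n -> R) by exact: measurable_indic.
  exact: measurableT_comp m1 (measurable_cmul G p).
rewrite integral_esum//; last 2 first.
- exact: countable_integral_points.
- by move=> p _; exact: measurable_funS (mphip p).
transitivity (\esum_(p in Gamma) \int[leb]_x (phi x * (\1_K (cmul G p x))%:E)).
  transitivity (\esum_(p in Gamma) \int[leb]_x (phi x * (\1_K (cmul G (- p) x))%:E)).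
    apply: eq_esum => p _; rewrite integral_mkcond.
    rewrite -[RHS](@integral_cmul _ _ _ G p); last 2 first.
    - by apply: emeasurable_funM => //.
    - by move=> x; rewrite mule_ge0// lee_fin.
    by apply: eq_integral => x _; rewrite cmulK epatch_indic.
  have bijN : set_bij Gamma Gamma (fun p => - p)%R.
    split=> [p|p p' _ _ /oppr_inj //|p pZ]; first exact: integral_pointsN.
    by exists (- p)%R; [exact: integral_pointsN|rewrite opprK].
  exact/esym/(reindex_esum _ _ _ (fun p => \int[leb]_x (phi x * (\1_K (cmul G p x))%:E)) bijN).
rewrite -integral_esum//; last 3 first.
- exact: countable_integral_points.
- by move=> p _; exact: emeasurable_funM.
- by move=> p x; rewrite mule_ge0// lee_fin.
(* Exactly one lattice element brings [x] into the cell. *)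
apply: eq_integral => x _; have [p pZ pK] := unit_cell_cover G x.
rewrite (@esum_unique _ _ _ _ p pZ) => [|p' p'Z p'p|].
- by rewrite indicE mem_set// mule1.
- rewrite indicE memNset ?mule0// => p'K; apply: p'p.
  exact: unit_cell_uniq p'K pK.
- by rewrite mule_ge0// lee_fin.
Qed.

End Balls.

Section FiberSums.
Context (R : realType).
Local Open Scope ereal_scope.

Lemma esum_mul_natl (T : choiceType) (A : set T) (a : T -> \bar R) (N : nat) :
  (forall i, 0 <= a i) -> \esum_(i in A) (N%:R%:E * a i) = N%:R%:E * \esum_(i in A) a i.
Proof.
move=> a0; rewrite -{2}(size_iota 0 N) -sume_const_seq ?esum_ge0//.
rewrite -esum_sum//; apply: eq_esum => i _.
by rewrite sume_const_seq// size_iota.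
Qed.

Let esumZr_le (T : choiceType) (A : set T) (a : T -> \bar R) (c : R) :
  (forall i, 0 <= a i) -> (0 <= c)%R ->
  \esum_(i in A) (a i * c%:E) <= (\esum_(i in A) a i) * c%:E.
Proof.
move=> a0 c0; apply: ge_ereal_sup => _ [X [finX XA]] <-.
rewrite fsbig_finite//= -ge0_sume_distrl//.
by rewrite lee_wpmul2r ?lee_fin// -fsbig_finite//; apply: esum_ge; exists X.
Qed.

Lemma esumZr (T : choiceType) (A : set T) (a : T -> \bar R) (c : R) :
  (forall i, 0 <= a i) -> (0 <= c)%R ->
  \esum_(i in A) (a i * c%:E) = (\esum_(i in A) a i) * c%:E.
Proof.
move=> a0 c0; apply/eqP; rewrite eq_le esumZr_le//=.
have [->|cn0] := eqVneq c 0%R.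
  by rewrite mule0 esum_ge0// => i _; rewrite mule0.
have {}c0 : (0 < c)%R by rewrite lt_neqAle eq_sym cn0.
rewrite -lee_pdivlMr//; apply: le_trans (esumZr_le _ _ _); last by rewrite invr_ge0 ltW.
  by apply: le_esum => i _; rewrite -muleA -EFinM divff ?gt_eqF// mule1.
by move=> i; rewrite mule_ge0// lee_fin ltW.
Qed.

(** The sum is grouped by the value of [w]. A covering list bounds each fibre without an explicit
    cardinality. *)
Lemma esum_fiber_le (T U : choiceType) (A : set T) (C : set U) (w : T -> U)
    (v : U -> \bar R) (N : nat) :
  (forall y, 0 <= v y) -> (forall k, A k -> C (w k)) ->
  (forall k, A k -> exists2 s : seq T, (size s <= N)%N &
    [set k' | A k' /\ w k' = w k] `<=` [set` s]) ->
  \esum_(k in A) v (w k) <= N%:R%:E * \esum_(y in C) v y.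
Proof.
move=> v0 wAC H; pose J y := [set k | A k /\ w k = y].
apply: (@le_trans _ _ (\esum_(y in C) \esum_(k in J y) v y)); last first.
  rewrite -esum_mul_natl//; apply: le_esum => y _.
  have [[k [Ak <-]]|Jy] := pselect (exists k, J y k); last first.
    rewrite (_ : J y = set0) ?esum_set0 ?mule_ge0 ?lee_fin//.
    by apply/seteqP; split=> // k Jk; apply: Jy; exists k.
  have [l sl Jl] := H k Ak; apply: (le_trans (esum_const_le (v0 _) Jl)).
  by rewrite lee_wpmul2r// lee_fin ler_nat.
rewrite esum_esum//; have bij : set_bij A (C `*`` J) (fun k => (w k, k)).
  split=> [k Ak|k k' _ _ [_ ->]//|[y k] /= [Cy [Ak wk]]].
    by split=> /=; [exact: wAC|split].
  by exists k => //; rewrite wk.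
by rewrite (reindex_esum _ _ _ (fun yk => v yk.1) bij).
Qed.

End FiberSums.

(** * Counting rational points near a point; first moments *)

Section Counting.
Context (R : realType) (n s : nat) (G : rational_carnot R n s).
Variable lam : nat -> R.
Hypothesis lam_gt0 : forall i, (1 <= i <= s)%N -> 0 < lam i.
Hypothesis wdist_triangle : forall x y z : 'rV[R]_n,
  wdist G lam x z <= wdist G lam x y + wdist G lam y z.
Local Open Scope ereal_scope.
Implicit Types x y z g p t u : 'rV[R]_n.

Local Notation leb := (lebesgue_rV R n).
Local Notation Gamma := (@integral_points R n).
Local Notation K := (@unit_cell R n).
Local Notation Q := (hausdorff_dim G).
Local Notation B := (unit_ball_volume G lam).

Definition ball_indic (r : R) x : \bar R := (\1_[set y | (wnorm G lam y <= r)%R] x)%:E.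

Lemma ball_indic_ge0 r x : 0 <= ball_indic r x.
Proof. by rewrite lee_fin. Qed.

Lemma ball_indicE r x : ball_indic r x = ((wnorm G lam x <= r)%R : bool)%:R%:E.
Proof. by rewrite /ball_indic indicE; congr (_%:R%:E); congr nat_of_bool; apply/idP/idP; rewrite inE. Qed.

Lemma measurable_ball_indic r : measurable_fun setT (ball_indic r).
Proof. by apply/measurable_EFinP; apply: measurable_indic; exact: measurable_wnorm_ball. Qed.

Lemma integral_ball_indic r : (0 <= r)%R -> \int[leb]_x ball_indic r x = (B * r ^+ Q)%:E.
Proof.
move=> r0; rewrite integral_indic ?setIT//; first exact: lebesgue_wnorm_ball.
exact: measurable_wnorm_ball.
Qed.

Lemma unit_cell_bounded : exists2 D : R, (0 <= D)%R & forall x, K x -> (wnorm G lam x <= D)%R.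
Proof.
have lam0 (i : 'I_n) : (0 < lam (deg G i))%R by exact/lam_gt0/deg_bound.
(* Being at least 1 and at least every weight, [D] satisfies
   [lam (deg G j) <= D <= D ^+ deg G j]. *)
pose D := (1 + \sum_(j < n) lam (deg G j))%R.
have D1 : (1 <= D)%R by rewrite lerDl sumr_ge0// => j _; exact: ltW.
exists D => [|x xK]; first by rewrite (le_trans _ D1).
apply/(wnorm_leP G lam_gt0) => [|j]; first by rewrite (le_trans _ D1).
have /andP[x0 x1] := xK j; rewrite ger0_norm// (le_trans (ltW x1))//.
rewrite ler_pdivlMr// mul1r; apply: (@le_trans _ _ D); last first.
  by rewrite -[leLHS]expr1 ler_weXn2l// deg_gt0.
by rewrite /D (bigD1 j)//= addrCA lerDl addr_ge0// sumr_ge0// => i _; exact: ltW.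
Qed.

(** Comparison of volumes: the cells [p K] with [p] in the ball are disjoint, have measure 1 and lie
    in the ball of radius [r + D]. The unfolding identity expresses this without a packing argument,
    uniformly in the centre. *)
Lemma lattice_count_le : exists2 D : R, (0 <= D)%R & forall z r, (0 <= r)%R ->
  \esum_(p in Gamma) ball_indic r (cmul G (- z) p) <= (B * (r + D) ^+ Q)%:E.
Proof.
have [D D0 KD] := unit_cell_bounded; exists D => // z r r0.
have mK := @measurable_unit_cell R n.
pose phi x := ball_indic (r + D) (cmul G (- z) x).
have mphi : measurable_fun setT phi.
  exact: measurableT_comp (measurable_ball_indic _) (measurable_cmul G _).
have mphip p : measurable_fun setT (fun x => phi (cmul G p x)).
  exact: measurableT_comp mphi (measurable_cmul G p).
rewrite -integral_ball_indic ?addr_ge0//.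
rewrite -[leRHS](@integral_cmul _ _ _ G (- z)); last 2 first.
- exact: measurable_ball_indic.
- exact: ball_indic_ge0.
rewrite -(integral_unfold G mphi) => [|x]; last exact: ball_indic_ge0.
rewrite integral_esum; first last.
- by move=> p x; exact: ball_indic_ge0.
- by move=> p _; exact: measurable_funS (mphip p).
- exact: countable_integral_points.
- exact: mK.
apply: le_esum => p _; rewrite ball_indicE.
have [pr|pr] := boolP (wnorm G lam (cmul G (- z) p) <= r)%R; last first.
  by apply: integral_ge0 => x _; exact: ball_indic_ge0.
have -> : 1%:R%:E = \int[leb]_(x in K) cst 1 x :> \bar R.
  by rewrite integral_cst// mul1e; exact/esym/lebesgue_unit_cell.
apply: ge0_le_integral; [exact: mK|by move=> x _; rewrite lee_fin|exact: measurable_cst|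
  exact: measurable_funS (mphip p)|].
move=> x xK; rewrite /phi ball_indicE cmulA (_ : (_ <= _)%R)//.
by rewrite (le_trans (wnorm_cmul wdist_triangle _ _))// lerD// KD.
Qed.

(** Extended values allow sums and integrals to be exchanged before the count is known to be
    finite. *)
Definition approx_count (q : nat) (r : R) g : \bar R :=
  \esum_(p in Gamma) ball_indic r (cmul G (- g) (dil G q%:R^-1 p)).

Lemma approx_count_ge0 q r g : 0 <= approx_count q r g.
Proof. by apply: esum_ge0 => p _; exact: ball_indic_ge0. Qed.

Lemma ball_indicN r x : ball_indic r (- x)%R = ball_indic r x.
Proof. by rewrite !ball_indicE wnormN. Qed.

Lemma measurable_ball_indic_cmulN r u : measurable_fun setT (fun g => ball_indic r (cmul G (- g) u)).
Proof.
under eq_fun do rewrite -ball_indicN cmulN opprK.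
exact: measurableT_comp (measurable_ball_indic _) (measurable_cmul G _).
Qed.

Lemma measurable_approx_count q r : measurable_fun setT (approx_count q r).
Proof.
apply: measurable_esum => //.
- exact: countable_integral_points.
- by move=> p _; exact: measurable_ball_indic_cmulN.
- by move=> p g; exact: ball_indic_ge0.
Qed.

(** As dilations are automorphisms, replacing [g] by [p g] amounts to permuting the lattice by left
    translation by [dil q p]. *)
Lemma approx_count_cmul q r p g : (0 < q)%N -> Gamma p ->
  approx_count q r (cmul G p g) = approx_count q r g.
Proof.
move=> q0 pZ; have qV : (0 < q%:R^-1 :> R)%R by rewrite invr_gt0 ltr0n.
have qn0 : (q%:R != 0 :> R)%R by rewrite pnatr_eq0 -lt0n.
have dilp := integral_points_dil G q pZ.
have bij : set_bij Gamma Gamma (cmul G (dil G q%:R p)).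
  split=> [p' p'Z|p' p'' _ _ /cmul_inj //|p' p'Z]; first exact: integral_points_cmul.
  exists (cmul G (- dil G q%:R p) p'); last by rewrite cmulVK.
  by apply: integral_points_cmul => //; exact: integral_pointsN.
apply: (etrans (reindex_esum _ _ _ (fun p' => ball_indic r
  (cmul G (- cmul G p g) (dil G q%:R^-1 p'))) bij)).
apply: eq_esum => p' _.
by rewrite (dil_cmul lam_gt0 wdist_triangle _ _ qV) (dilK _ qn0) cmulN -cmulA cmulK.
Qed.

(** Every integral point is uniquely [dil q (p^-1) * t] with [t] a representative. The inner sum
    then runs over the orbit of [g], which is the shape that [integral_unfold] accepts. *)
Lemma approx_count_fold q r g : (0 < q)%N -> approx_count q r g =
  \sum_(t <- lattice_reps G q)
    \esum_(p in Gamma) ball_indic r (cmul G (- cmul G p g) (dil G q%:R^-1 t)).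
Proof.
move=> q0; have qV : (0 < q%:R^-1 :> R)%R by rewrite invr_gt0 ltr0n.
have qn0 : (q%:R != 0 :> R)%R by rewrite pnatr_eq0 -lt0n.
rewrite -esum_seq ?lattice_reps_uniq//; last first.
  by move=> t; apply: esum_ge0 => p _; exact: ball_indic_ge0.
rewrite esum_esum; last by move=> *; exact: ball_indic_ge0.
have bij : set_bij ([set` lattice_reps G q] `*`` (fun=> Gamma)) Gamma
    (fun tp => cmul G (dil G q%:R (- tp.2)) tp.1).
  split=> [[t p] [/= /(mem_lattice_reps _ _ q0)[tZ _] pZ]|[t p] [t' p']|p pZ].
  - apply: integral_points_cmul => //; apply: integral_points_dil.
    exact: integral_pointsN.
  - rewrite !inE /= => -[/(mem_lattice_reps _ _ q0)[tZ tK] pZ].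
    move=> [/(mem_lattice_reps _ _ q0)[tZ' tK'] pZ'] E.
    suff pp : p = p' by move: E; rewrite pp => /cmul_inj ->.
    have /(congr1 (dil G q%:R^-1)) := E.
    rewrite !(dil_cmul lam_gt0 wdist_triangle _ _ qV) !(dilK _ qn0) => {}E.
    (* After dilation by [q^-1], both representatives lie in the unit cell and in the same lattice
       orbit. *)
    have := @unit_cell_uniq _ _ _ G (dil G q%:R^-1 t) 0 (cmul G p' (- p)).
    rewrite cmul0g -cmulA E cmulVK => /(_ (@integral_points0 R n)).
    move=> /(_ (integral_points_cmul G pZ' (integral_pointsN pZ)) tK tK').
    by move=> /(congr1 (fun y => cmul G y p)); rewrite -cmulA cmulVg cmulg0 cmul0g.
  - have [p' p'Z p'K] := unit_cell_cover G (dil G q%:R^-1 p).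
    exists (cmul G (dil G q%:R p') p, p'); last by rewrite /= dilN cmulK.
    split=> //=; apply/(mem_lattice_reps _ _ q0); split.
      by apply: integral_points_cmul => //; exact: integral_points_dil.
    by rewrite (dil_cmul lam_gt0 wdist_triangle _ _ qV) (dilK _ qn0).
apply: (etrans (reindex_esum _ _ _ (fun p => ball_indic r
  (cmul G (- g) (dil G q%:R^-1 p))) bij)).
apply: eq_esum => -[t p] _ /=.
by rewrite (dil_cmul lam_gt0 wdist_triangle _ _ qV) (dilK _ qn0) cmulN -cmulA.
Qed.

(** Fold, then unfold. The weight [H] is 1 for the mean and a second count for the correlation; its
    invariance lets it follow the change of variable. *)
Lemma integral_approx_count q r (H : 'rV[R]_n -> \bar R) : (0 < q)%N -> (0 <= r)%R ->
  measurable_fun setT H -> (forall x, 0 <= H x) ->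
  (forall x, H x \is a fin_num) -> (forall p x, Gamma p -> H (cmul G p x) = H x) ->
  \int[leb]_(x in K) (approx_count q r x * H x) =
  \sum_(t <- lattice_reps G q)
     \int[leb]_x (ball_indic r x * H (cmul G (dil G q%:R^-1 t) x)).
Proof.
move=> q0 r0 mH H0 Hfin HG; have mK := @measurable_unit_cell R n.
pose phi t x := ball_indic r (cmul G (- x) (dil G q%:R^-1 t)) * H x.
have mphi t : measurable_fun setT (phi t).
  by apply: emeasurable_funM => //; exact: measurable_ball_indic_cmulN.
have phi0 t x : 0 <= phi t x by rewrite mule_ge0// ball_indic_ge0.
transitivity (\sum_(t <- lattice_reps G q)
    \int[leb]_(x in K) (\esum_(p in Gamma) phi t (cmul G p x))).
  rewrite -ge0_integral_sum//; last 2 first.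
  - move=> t; apply: measurable_esum; first exact: countable_integral_points.
      move=> p _.
      exact: measurable_funS (measurableT_comp (mphi t) (measurable_cmul G p)).
    by move=> p x; exact: phi0.
  - by move=> t x _; exact: esum_ge0.
  apply: eq_integral => x _; rewrite (approx_count_fold _ _ q0).
  rewrite ge0_sume_distrl => [|t _]; last by apply: esum_ge0 => p _; exact: ball_indic_ge0.
  apply: eq_bigr => t _; rewrite -(fineK (Hfin x)) -esumZr; last 2 first.
  - by move=> p; exact: ball_indic_ge0.
  - by rewrite fine_ge0.
  by apply: eq_esum => p pZ; rewrite (fineK (Hfin x)) /phi HG.
apply: eq_bigr => t _; rewrite (integral_unfold _ (mphi t) (phi0 t)).
(* This translation recentres the ball at the origin. *)
rewrite -(integral_cmul G (dil G q%:R^-1 t) (mphi t) (phi0 t)).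
apply: eq_integral => x _; rewrite /phi; congr (_ * _).
by rewrite cmulN -cmulA cmulVg cmulg0 ball_indicN.
Qed.

Lemma mean_approx_count q r : (0 < q)%N -> (0 <= r)%R ->
  \int[leb]_(x in K) approx_count q r x = (q%:R ^+ Q * (B * r ^+ Q))%:E.
Proof.
move=> q0 r0; have := integral_approx_count q0 r0 (H := cst 1) (ltac:(done))
  (ltac:(done)) (ltac:(done)) (ltac:(done)).
under eq_integral do rewrite mule1; move=> ->.
under eq_bigr do under eq_integral do rewrite mule1.
under eq_bigr do rewrite (integral_ball_indic r0).
rewrite sume_const_seq; first by rewrite size_lattice_reps// natrX EFinM.
by rewrite lee_fin mulr_ge0 ?exprn_ge0// ltW// unit_ball_volume_gt0.
Qed.

(** Gauss's lemma in each coordinate, since [a ^ deg G j] and [b ^ deg G j] are coprime. *)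
Lemma dil_coprime (a b : nat) x y : (0 < a)%N -> (0 < b)%N -> coprime a b -> Gamma x -> Gamma y ->
  dil G a%:R x = dil G b%:R y ->
  exists p, [/\ Gamma p, y = dil G a%:R p & x = dil G b%:R p].
Proof.
move=> a0 b0 ab xZ yZ E; pose p := dil G a%:R^-1 y.
have an0 : (a%:R != 0 :> R)%R by rewrite pnatr_eq0 -lt0n.
have bn0 : (b%:R != 0 :> R)%R by rewrite pnatr_eq0 -lt0n.
have yE : y = dil G a%:R p by rewrite /p (dilVK G an0).
exists p; split; [move=> j|exact: yE|]; last first.
  by apply: (can_inj (dilK G an0)); rewrite E {1}yE !dilM [(b%:R * _)%R]mulrC.
rewrite mxE.
have := congr1 (fun z : 'rV[R]_n => z ord0 j) E; rewrite !mxE.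
have /intrP[u ->] := xZ j; have /intrP[v yv] := yZ j; rewrite yv.
rewrite exprVn -!natrX -![(_%:R : R)%R]/((_%:Z)%:~R)%R -!intrM => /intr_inj uv.
have /dvdzP[w ->] : ((a ^ deg G j)%N %| v)%Z.
  have : coprimez (a ^ deg G j)%N (b ^ deg G j)%N by rewrite coprimezE/= coprimeXl// coprimeXr.
  by move=> /Gauss_dvdzr <-; apply/dvdzP; exists u; rewrite -uv mulrC.
rewrite intrM mulrCA mulVf ?mulr1 ?rpred_int//.
by rewrite intr_eq0 eqz_nat -lt0n expn_gt0 a0.
Qed.

End Counting.

(** * Correlation of two counts *)

Section Correlation.
Context (R : realType) (n s : nat) (G : rational_carnot R n s).
Variable lam : nat -> R.
Hypothesis lam_gt0 : forall i, (1 <= i <= s)%N -> 0 < lam i.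
Hypothesis wdist_triangle : forall x y z : 'rV[R]_n,
  wdist G lam x z <= wdist G lam x y + wdist G lam y z.
Local Open Scope ereal_scope.
Implicit Types x y z g p t u : 'rV[R]_n.

Local Notation leb := (lebesgue_rV R n).
Local Notation Gamma := (@integral_points R n).
Local Notation K := (@unit_cell R n).
Local Notation Q := (hausdorff_dim G).
Local Notation B := (unit_ball_volume G lam).
Let dilMc := dil_cmul lam_gt0 wdist_triangle.

Lemma ball_indic_dil r (t : R) x : (0 < t)%R -> (0 <= r)%R ->
  ball_indic G lam (t * r) (dil G t x) = ball_indic G lam r x.
Proof. by move=> t0 r0; rewrite !ball_indicE wnorm_dil_le. Qed.

(* [p] is determined by its class modulo [dil d Gamma], since it lies in a
   prescribed translate of the fundamental domain of [dil d Gamma]. *)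
Lemma dil_cell_count (d : nat) u : (0 < d)%N ->
  exists f : 'rV[R]_n -> 'rV[R]_n, forall p, Gamma p -> unit_cell (cmul G (dil G d%:R^-1 p) u) ->
    exists2 t, t \in lattice_reps G d & p = f t.
Proof.
move=> d0; have dV : (0 < d%:R^-1 :> R)%R by rewrite invr_gt0 ltr0n.
have dR : (0 < d%:R :> R)%R by rewrite ltr0n.
have dn0 : (d%:R != 0 :> R)%R by rewrite pnatr_eq0 -lt0n.
have /choice[red redP] : forall x, exists p, Gamma p /\ unit_cell (cmul G p x).
  by move=> x; have [p pZ pK] := unit_cell_cover G x; exists p.
(* If [t = dil d c * p] with [c] moving [dil d^-1 p] into the cell, then [red] finds [c^-1] from [t]
   and [u] alone, because it moves [dil d^-1 t * u] back into the cell. *)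
exists (fun t => cmul G (dil G d%:R (red (cmul G (dil G d%:R^-1 t) u))) t) => p pZ pK.
have [c cZ cK] := unit_cell_cover G (dil G d%:R^-1 p).
exists (cmul G (dil G d%:R c) p).
  apply/(mem_lattice_reps _ _ d0); split.
    by apply: integral_points_cmul => //; exact: integral_points_dil.
  by rewrite (dilMc _ _ dV) (dilK _ dn0).
rewrite (dilMc _ _ dV) (dilK _ dn0) -cmulA.
set y := cmul G c _; have [rZ rK] := redP y.
have -> : red y = (- c)%R.
  apply: (unit_cell_uniq rZ (integral_pointsN cZ) rK).
  by rewrite /y cmulK.
by rewrite dilN cmulK.
Qed.

(** The factor [L] is the least common multiple of [q] and [q']: dilating by it clears both
    denominators and sends the difference of the two rational points to a lattice point. *)
Lemma approx_count_correlation_sum q q' d (L r : R) z :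
  (0 < q)%N -> (0 < q')%N -> (0 <= r)%R ->
  d = gcdn q q' -> L = (q * (q' %/ d))%:R%R ->
  \sum_(t <- lattice_reps G q) approx_count G lam q' r (cmul G (dil G q%:R^-1 t) z) <=
  (d ^ Q)%:R%:E * \esum_(p in Gamma) ball_indic G lam (L * r) (cmul G (- dil G L z) p).
Proof.
move=> q0 q'0 r0 dE LE.
have d0 : (0 < d)%N by rewrite dE gcdn_gt0 q0.
pose a := (q %/ d)%N; pose b := (q' %/ d)%N.
have qE : q = (a * d)%N by rewrite divnK// dE dvdn_gcdl.
have q'E : q' = (b * d)%N by rewrite divnK// dE dvdn_gcdr.
have a0 : (0 < a)%N by move: q0; rewrite qE muln_gt0 => /andP[].
have b0 : (0 < b)%N by move: q'0; rewrite q'E muln_gt0 => /andP[].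
have ab : coprime a b by rewrite /coprime -(eqn_pmul2r d0) muln_gcdl mul1n -qE -q'E dE.
have posR (m : nat) : (0 < m)%N -> (0 < m%:R :> R)%R by rewrite ltr0n.
have neqR (m : nat) : (0 < m)%N -> (m%:R != 0 :> R)%R by rewrite pnatr_eq0 -lt0n.
have posV (m : nat) : (0 < m)%N -> (0 < m%:R^-1 :> R)%R by rewrite invr_gt0 ltr0n.
have L0 : (0 < L)%R by rewrite LE ltr0n muln_gt0 q0.
have Lq : (L * q%:R^-1 = b%:R)%R by rewrite LE natrM mulrAC divff ?mul1r// neqR.
have Lq' : (L * q'%:R^-1 = a%:R)%R.
  by rewrite LE {1}qE mulnAC -/b -mulnA -q'E natrM -mulrA divff ?mulr1// neqR.
pose w (tp : 'rV[R]_n * 'rV[R]_n) := cmul G (- dil G b%:R tp.1) (dil G a%:R tp.2).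
pose A := [set` lattice_reps G q] `*`` (fun=> Gamma).
rewrite -esum_seq ?lattice_reps_uniq//; last by move=> t; exact: approx_count_ge0.
rewrite /approx_count esum_esum; last by move=> *; exact: ball_indic_ge0.
have -> : \esum_(k in A) ball_indic G lam r
    (cmul G (- cmul G (dil G q%:R^-1 k.1) z) (dil G q'%:R^-1 k.2)) =
  \esum_(k in A) ball_indic G lam (L * r) (cmul G (- dil G L z) (w k)).
  apply: eq_esum => -[t p] _; rewrite -(ball_indic_dil _ L0 r0) (dilMc _ _ L0).
  by rewrite dilN (dilMc _ _ L0) !dilM Lq Lq' cmulN -cmulA.
apply: (@esum_fiber_le _ _ _ A Gamma w (fun y => ball_indic G lam (L * r)
  (cmul G (- dil G L z) y))) => [y|[t p] [/(mem_lattice_reps _ _ q0)[tZ _] pZ]|].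
- exact: ball_indic_ge0.
- apply: integral_points_cmul; last exact: integral_points_dil.
  by apply: integral_pointsN; exact: integral_points_dil.
move=> [t p] [/(mem_lattice_reps _ _ q0)[tZ tK] /= pZ].
have [f fP] := dil_cell_count (dil G q%:R^-1 t) d0.
exists [seq (cmul G (dil G a%:R (f c)) t, cmul G (dil G b%:R (f c)) p) | c <- lattice_reps G d].
  by rewrite size_map size_lattice_reps.
move=> [t' p'] [] [/(mem_lattice_reps _ _ q0)[tZ' tK'] /= pZ'].
rewrite /w /= => wE.
(* Two pairs with the same [w] differ by [dil b (t' t^-1) = dil a (p' p^-1)]; by coprimality they
   differ by [(dil a c, dil b c)] for one integral [c]. *)
have E : dil G a%:R (cmul G p' (- p)) = dil G b%:R (cmul G t' (- t)).
  have /(congr1 (fun y => cmul G (cmul G (dil G b%:R t') y) (- dil G a%:R p))) := wE.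
  rewrite cmulVK -!cmulA cmulgV cmulg0 => E.
  by rewrite (dilMc _ _ (posR _ a0)) (dilMc _ _ (posR _ b0)) !dilN.
have [||c [cZ tc pc]] := dil_coprime a0 b0 ab _ _ E.
- by apply: integral_points_cmul => //; exact: integral_pointsN.
- by apply: integral_points_cmul => //; exact: integral_pointsN.
have t'E : t' = cmul G (dil G a%:R c) t by rewrite -tc -cmulA cmulVg cmulg0.
have p'E : p' = cmul G (dil G b%:R c) p by rewrite -pc -cmulA cmulVg cmulg0.
(* Since [a / q = 1 / d], the condition that [t'] is a representative confines [c] to a translated
   cell of scale [d], which has [d ^ Q] integral points. *)
have [|u ud cu] := fP c cZ.
  move: tK'; rewrite t'E (dilMc _ _ (posV _ q0)) dilM.
  by rewrite (_ : q%:R^-1 * a%:R = d%:R^-1)%R// qE natrM invfM mulrAC mulVf ?mul1r// neqR.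
by apply/mapP; exists u => //; rewrite t'E p'E cu.
Qed.

Lemma approx_count_correlation : exists2 D : R, (0 <= D)%R &
  (forall q r g, (0 < q)%N -> (0 <= r)%R -> approx_count G lam q r g \is a fin_num) /\
  forall q q' r r', (0 < q)%N -> (0 < q')%N -> (0 <= r)%R -> (0 <= r')%R ->
  \int[leb]_(x in K) (approx_count G lam q r x * approx_count G lam q' r' x) <=
  ((gcdn q q')%:R ^+ Q * (B * ((q * (q' %/ gcdn q q'))%:R * r' + D) ^+ Q) * (B * r ^+ Q))%:E.
Proof.
have [D D0 HD] := lattice_count_le lam_gt0 wdist_triangle; exists D => //.
(* Dilating by [q] turns the count into the number of lattice points in a ball of radius [q r]. *)
have fin q r g : (0 < q)%N -> (0 <= r)%R -> approx_count G lam q r g \is a fin_num.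
  move=> q0 r0; have qn0 : (q%:R != 0 :> R)%R by rewrite pnatr_eq0 -lt0n.
  have qR : (0 < q%:R :> R)%R by rewrite ltr0n.
  rewrite ge0_fin_numE; last exact: approx_count_ge0.
  apply: le_lt_trans (ltry (B * (q%:R * r + D) ^+ Q)%R).
  apply: le_trans (HD (dil G q%:R g) _ _); last by rewrite mulr_ge0.
  apply: le_esum => p _.
  by rewrite -(ball_indic_dil _ qR r0) (dilMc _ _ qR) dilN (dilVK _ qn0).
split=> // q q' r r' q0 q'0 r0 r'0.
have r'L : (0 <= (q * (q' %/ gcdn q q'))%:R * r')%R by rewrite mulr_ge0.
have mH := measurable_approx_count G lam_gt0 q' r'.
rewrite (integral_approx_count lam_gt0 wdist_triangle q0 r0 mH); last 3 first.
- exact: approx_count_ge0.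
- by move=> x; exact: fin.
- by move=> p x pZ; rewrite approx_count_cmul.
have mb := measurable_ball_indic G lam_gt0 r.
have mt (t : 'rV[R]_n) : measurable_fun setT (fun x =>
    ball_indic G lam r x * approx_count G lam q' r' (cmul G (dil G q%:R^-1 t) x)).
  exact: emeasurable_funM mb (measurableT_comp mH (measurable_cmul G _)).
have mK := @measurable_unit_cell R n.
have t0 (t x : 'rV[R]_n) : 0 <=
    ball_indic G lam r x * approx_count G lam q' r' (cmul G (dil G q%:R^-1 t) x).
  by apply: mule_ge0; [exact: ball_indic_ge0|exact: approx_count_ge0].
rewrite -ge0_integral_sum; [|exact: measurableT|exact: mt|by move=> t x _; exact: t0].
set c := ((gcdn q q')%:R ^+ Q * (B * _))%R.
have c0 : (0 <= c)%R.
  by rewrite mulr_ge0 ?exprn_ge0// mulr_ge0 ?exprn_ge0 ?addr_ge0// ltW// unit_ball_volume_gt0.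
rewrite EFinM -(integral_ball_indic G lam_gt0 r0) -ge0_integralZl_EFin; first last.
- exact: c0.
- exact: mb.
- by move=> x _; exact: ball_indic_ge0.
- exact: measurableT.
apply: ge0_le_integral.
- exact: measurableT.
- by move=> x _; apply: sume_ge0 => t _; exact: t0.
- by apply: emeasurable_sum => t; exact: mt.
- exact: emeasurable_funM (measurable_cst _) mb.
move=> x _; rewrite -ge0_sume_distrr => [|t _]; last exact: approx_count_ge0.
rewrite muleC lee_wpmul2r ?ball_indic_ge0//.
apply: (le_trans (approx_count_correlation_sum _ q0 q'0 r'0 erefl erefl)).
by rewrite /c -natrX EFinM lee_wpmul2l ?lee_fin//; exact: HD.
Qed.

End Correlation.

(** * An explicit bound for convergent power sums *)

Section PowerSeries.
Context (R : realType).

(** Comparison of [y^(-1-d)] with the integral of [t^(-1-d)] over [y - 1, y], obtained from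
    [1 + u <= expR u] and [ln (1 - u) <= - u]. *)
Let powRN_step (d y : R) : 0 < d -> 1 < y ->
  y `^ (- (1 + d)) <= d^-1 * ((y - 1) `^ (- d) - y `^ (- d)).
Proof.
move=> d0 y1; have y0 : 0 < y by rewrite (lt_trans ltr01).
have z0 : 0 < y - 1 by rewrite subr_gt0.
rewrite -ler_pdivrMl ?invr_gt0// invrK lerBrDr.
have -> : y `^ (- (1 + d)) = y^-1 * y `^ (- d).
  rewrite opprD powRD ?powR_inv1 ?(ltW y0)//.
  by rewrite (gt_eqF y0) implybT.
rewrite mulrA -[X in _ + X <= _]mul1r -mulrDl.
apply: (@le_trans _ _ (expR (d * y^-1) * y `^ (- d))).
  by rewrite ler_wpM2r ?powR_ge0// addrC expR_ge1Dx.
rewrite /powR (gt_eqF y0) (gt_eqF z0) -expRD ler_expR.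
have -> : ln (y - 1) = ln y + ln (1 - y^-1).
  rewrite -lnM ?posrE//; last by rewrite subr_gt0 invf_lt1.
  by rewrite mulrBr divff ?gt_eqF// mulr1.
have : ln (1 - y^-1) <= - y^-1 by rewrite le_ln1Dx// ltrN2 invf_lt1.
by nra.
Qed.

Lemma powRN_series_le (d : R) (N : nat) : 0 < d ->
  \sum_(0 <= k < N) k.+1%:R `^ (- (1 + d)) <= 1 + d^-1.
Proof.
move=> d0; have dV : 0 < d^-1 by rewrite invr_gt0.
(* The sharper bound telescopes. *)
suff H M : \sum_(0 <= k < M.+1) (k.+1%:R : R) `^ (- (1 + d)) <=
    1 + d^-1 * (1 - M.+1%:R `^ (- d)).
  case: N => [|N]; first by rewrite big_nil addr_ge0// ltW.
  apply: (le_trans (H N)); have := powR_ge0 (N.+1%:R : R) (- d).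
  by nra.
elim: M => [|M IH]; first by rewrite big_nat1 !powR1 subrr mulr0 addr0.
have y1 : 1 < M.+2%:R :> R by rewrite ltr1n.
rewrite big_nat_recr//=; have := powRN_step d0 y1.
have -> : M.+2%:R - 1 = M.+1%:R :> R by rewrite -natr1 addrK.
move=> H; apply: (le_trans (lerD IH H)).
by rewrite -addrA -mulrDr addrA subrK.
Qed.

End PowerSeries.

(** * The Rademacher-Menshov argument *)

Section DyadicSquares.
Context (R : realType).
Implicit Types m a j : nat.

(** The sum of the squared block sums over all dyadic subintervals of [a, a + 2^m), at every scale
    down to single terms. *)
Fixpoint dyadic_sq (x : nat -> R) m a : R :=
  if m is m'.+1 then dyadic_sq x m' a + dyadic_sq x m' (a + 2 ^ m') +
    (\sum_(a <= k < a + 2 ^ m) x k) ^+ 2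
  else x a ^+ 2.

Lemma dyadic_sq_ge0 (x : nat -> R) m a : 0 <= dyadic_sq x m a.
Proof.
by elim: m a => [|m IH] a /=; rewrite ?sqr_ge0// !addr_ge0 ?sqr_ge0.
Qed.

Let dyadic_sq_full (x : nat -> R) m a : (\sum_(a <= k < a + 2 ^ m) x k) ^+ 2 <= dyadic_sq x m a.
Proof.
case: m => [|m]; first by rewrite expn0 addn1 big_nat1.
by rewrite [leRHS]/= lerDr addr_ge0 ?dyadic_sq_ge0.
Qed.

(* Cauchy-Schwarz over the at most [m.+1] dyadic intervals that make up
   [a, a + j). *)
Lemma sum_sq_le_dyadic (x : nat -> R) m a j : (j <= 2 ^ m)%N ->
  (\sum_(a <= k < a + j) x k) ^+ 2 <= m.+1%:R * dyadic_sq x m a.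
Proof.
elim: m a j => [|m IH] a j jm.
  rewrite mul1r; case: j jm => [|[|//]] _; last by rewrite addn1 big_nat1.
  by rewrite addn0 big_geq// expr0n/= sqr_ge0.
have Q1 := dyadic_sq_ge0 x m a; have Q2 := dyadic_sq_ge0 x m (a + 2 ^ m).
have := sqr_ge0 (\sum_(a <= k < a + 2 ^ m.+1) x k).
have M0 : 0 < m.+1%:R :> R by rewrite ltr0n.
have ME : m.+2%:R = m.+1%:R + 1 :> R by rewrite natr1.
rewrite ME [dyadic_sq _ _ _]/=; set T := (X in 0 <= X) => T0.
have [jm'|jm'] := leqP j (2 ^ m).
  have := IH a j jm'; set S := (\sum_(_ <= _ < _) _) ^+ 2.
  by nra.
have [j' jE] : exists j', j = (2 ^ m + j')%N by exists (j - 2 ^ m)%N; rewrite subnKC// ltnW.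
have j'm : (j' <= 2 ^ m)%N by move: jm; rewrite jE expnS mul2n -addnn leq_add2l.
rewrite jE addnA (big_cat_nat (n := a + 2 ^ m))/= ?leq_addr//.
have := IH (a + 2 ^ m)%N j' j'm; have := dyadic_sq_full x m a.
set S1 := (\sum_(a <= _ < _) _); set S2 := (\sum_(a + 2 ^ m <= _ < _) _).
move: Q1 Q2 T0; set q1 := dyadic_sq _ _ _; set q2 := dyadic_sq _ _ _.
clearbody q1 q2 S1 S2 T; move: M0; move: (m.+1%:R : R) => M M0 q10 q20 T0 H1 H2.
(* This square gives [M (S1 + S2)^2 <= (M + 1) (M S1^2 + S2^2)]: Cauchy-Schwarz with weight 1 for
   the full left half and [M] for the pieces of the right half. *)
have H3 : 0 <= (M * S1 - S2) ^+ 2 by exact: sqr_ge0.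
have H4 : (S1 + S2) ^+ 2 <= (M + 1) * (q1 + q2).
  rewrite -(ler_pM2l M0).
  have -> : M * (S1 + S2) ^+ 2 = (M + 1) * (M * S1 ^+ 2 + S2 ^+ 2) - (M * S1 - S2) ^+ 2.
    by ring.
  apply: (@le_trans _ _ ((M + 1) * (M * S1 ^+ 2 + S2 ^+ 2))); first by rewrite gerBl.
  have M0' := ltW M0; rewrite [leRHS]mulrCA.
  have H5 : M * S1 ^+ 2 <= M * q1 by rewrite ler_wpM2l.
  by rewrite ler_wpM2l ?addr_ge0// [leRHS]mulrDr lerD.
by apply: (le_trans H4); rewrite ler_wpM2l ?addr_ge0 ?(ltW M0)// lerDl sqr_ge0.
Qed.

Section Integral.
Context d (X : measurableType d) (mu : {measure set X -> \bar R}) (D : set X).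
Variables (F : nat -> X -> R) (C : R).
Hypothesis mD : measurable D.
Hypothesis mF : forall k, measurable_fun D (F k).
Hypothesis F_var : forall a j,
  (\int[mu]_(x in D) ((\sum_(a <= k < a + j) F k x) ^+ 2)%:E <= (C * j%:R)%:E)%E.

Lemma measurable_dyadic_sq m a : measurable_fun D (fun x => dyadic_sq (F ^~ x) m a).
Proof.
elim: m a => [|m IH] a /=; first exact: measurable_funX.
apply: measurable_funD; first by apply: measurable_funD; exact: IH.
by apply: measurable_funX; apply: measurable_sum => k; exact: mF.
Qed.

(** Each of the [m.+1] scales partitions an interval of length 2^m, so the linear variance bound
    gives it at most [C * 2 ^+ m]. *)
Lemma integral_dyadic_sq m a :
  (\int[mu]_(x in D) (dyadic_sq (F ^~ x) m a)%:E <= (C * (m.+1%:R * 2 ^+ m))%:E)%E.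
Proof.
have mQ m' a' : measurable_fun D (fun x => (dyadic_sq (F ^~ x) m' a')%:E).
  by apply/measurable_EFinP; exact: measurable_dyadic_sq.
have Q0 m' a' x : (0 <= (dyadic_sq (F ^~ x) m' a')%:E)%E by rewrite lee_fin dyadic_sq_ge0.
elim: m a => [|m IH] a.
  rewrite /= expr0 !mulr1; have := F_var a 1; rewrite mulr1.
  by under eq_integral do rewrite addn1 big_nat1.
have mS : measurable_fun D (fun x => ((\sum_(a <= k < a + 2 ^ m.+1) F k x) ^+ 2)%:E).
  apply/measurable_EFinP; apply: measurable_funX.
  by apply: measurable_sum => k; exact: mF.
under eq_integral do rewrite [dyadic_sq _ _ _]/= !EFinD.
rewrite ge0_integralD//; last 3 first.
- by move=> x _; rewrite adde_ge0.
- exact: emeasurable_funD.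
- by move=> x _; rewrite lee_fin sqr_ge0.
rewrite ge0_integralD//.
have -> : C * (m.+2%:R * 2 ^+ m.+1) =
    C * (m.+1%:R * 2 ^+ m) + C * (m.+1%:R * 2 ^+ m) + C * (2 ^ m.+1)%:R.
  by rewrite natrX -natr1 exprS; ring.
by rewrite !EFinD !leeD.
Qed.

(* Markov's inequality at every dyadic scale m, with the summable weights
   (m + 1)^-(1 + eps). *)
Lemma ae_sum_sq_le (eps : R) : 0 < eps ->
  {ae mu, forall x, D x -> exists A : R, forall m j, (j <= 2 ^ m)%N ->
    (\sum_(0 <= k < j) F k x) ^+ 2 <= A * 2 ^+ m * m.+1%:R `^ (3 + eps)}.
Proof.
move=> eps0; pose c m : R := (2 ^+ m * m.+1%:R `^ (2 + eps))^-1.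
have c0 m : 0 < c m by rewrite invr_gt0 mulr_gt0 ?exprn_gt0// powR_gt0// ltr0n.
have cE m : c m * (m.+1%:R * 2 ^+ m) = m.+1%:R `^ (- (1 + eps)).
  have m0 : 0 < m.+1%:R :> R by rewrite ltr0n.
  have -> : - (1 + eps) = 1 + (- (2 + eps)) by ring.
  rewrite powRD ?(gt_eqF m0) ?implybT// powRr1 ?(ltW m0)// powRN /c.
  have u0 : 2 ^+ m != 0 :> R by rewrite expf_neq0.
  have p0 : m.+1%:R `^ (2 + eps) != 0 :> R by rewrite gt_eqF// powR_gt0.
  by move: u0 p0; move: (2 ^+ m) (m.+1%:R `^ (2 + eps)) => u p u0 p0; field; rewrite u0 p0.
have mQ m : measurable_fun D (fun x => (c m * dyadic_sq (F ^~ x) m 0)%:E).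
  apply/measurable_EFinP; apply: measurable_funM; first exact: measurable_cst.
  exact: measurable_dyadic_sq.
have Q0 m x : (0 <= (c m * dyadic_sq (F ^~ x) m 0)%:E)%E.
  by rewrite lee_fin mulr_ge0 ?dyadic_sq_ge0// ltW.
pose T x := (\sum_(m <oo) (c m * dyadic_sq (F ^~ x) m 0)%:E)%E.
have T0 x : (0 <= T x)%E by apply: nneseries_ge0.
have mT : measurable_fun D T by apply: ge0_emeasurable_sum.
have C0 : 0 <= C.
  have := F_var 0 1; rewrite mulr1 -lee_fin; apply: le_trans.
  by apply: integral_ge0 => x _; rewrite lee_fin sqr_ge0.
have iT : mu.-integrable D T.
  apply/integrableP; split=> //; under eq_integral do rewrite gee0_abs//.
  rewrite integral_nneseries//.
  apply: (@le_lt_trans _ _ (C * (1 + eps^-1))%:E); last exact: ltry.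
  apply: lime_le; first by apply: is_cvg_nneseries => m _ _; exact: integral_ge0.
  apply: nearW => N; apply: (@le_trans _ _
      (\sum_(0 <= m < N) (C * m.+1%:R `^ (- (1 + eps)))%:E)%E).
    apply: lee_sum => m _; under eq_integral do rewrite EFinM.
    rewrite ge0_integralZl_EFin//; last 3 first.
    - by move=> x _; rewrite lee_fin dyadic_sq_ge0.
    - by apply/measurable_EFinP; exact: measurable_dyadic_sq.
    - exact: ltW.
    rewrite -cE mulrCA EFinM lee_pmul2l ?lte_fin//.
    exact: integral_dyadic_sq.
  by rewrite sumEFin lee_fin -mulr_sumr ler_wpM2l// powRN_series_le.
have := integrable_ae mD iT; apply: filterS => x Tfin Dx.
(* A single term of the convergent series bounds [dyadic_sq] with exponent [2 + eps]; Cauchy-Schwarz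
   adds one more factor [m.+1]. *)
exists (fine (T x)) => m j jm.
apply: (le_trans (sum_sq_le_dyadic (F ^~ x) 0 jm)).
have : ((c m * dyadic_sq (F ^~ x) m 0)%:E <= T x)%E.
  apply: le_trans (nneseries_lim_ge m.+1 _); last by move=> *; exact: Q0.
  by rewrite big_nat_recr//= leeDr// sume_ge0.
rewrite -(fineK (Tfin Dx)) lee_fin /c ler_pdivrMl; last first.
  by rewrite mulr_gt0 ?exprn_gt0// powR_gt0// ltr0n.
move=> H; have m0 : 0 < m.+1%:R :> R by rewrite ltr0n.
apply: (le_trans (ler_wpM2l (ltW m0) H)).
have -> : m.+1%:R `^ (3 + eps) = m.+1%:R * m.+1%:R `^ (2 + eps).
  have -> : 3 + eps = 1 + (2 + eps) by ring.
  by rewrite powRD ?(gt_eqF m0) ?implybT// powRr1 ?(ltW m0).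
by rewrite le_eqVlt; apply/orP; left; apply/eqP; ring.
Qed.

End Integral.
End DyadicSquares.

(** * Arithmetic sums over reduced denominators *)

Section GcdSums.
Context (R : realType).

(** The value [a = q / gcd(q, k)] forces [k = b (q / a)] with [1 <= b <= a], so it is taken at most
    [a] times. *)
Lemma sum_reduced_den_le (h : nat -> R) (q : nat) : (0 < q)%N -> (forall a, 0 <= h a) ->
  \sum_(1 <= k < q.+1) h (q %/ gcdn q k)%N <= \sum_(1 <= a < q.+1) a%:R * h a.
Proof.
move=> q0 h0; pose s := index_iota 1 q.+1; pose A k := (q %/ gcdn q k)%N.
have AE k : (A k * gcdn q k)%N = q by rewrite divnK// dvdn_gcdl.
have As k : A k \in s.
  rewrite mem_index_iota ltnS div.leq_div andbT.
  by move: q0; rewrite -{1}(AE k) muln_gt0 => /andP[].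
apply: (@le_trans _ _ (\sum_(k <- s) \sum_(a <- s | A k == a) h a)).
  apply: ler_sum => k _; rewrite big_mkcond (bigD1_seq (A k) (As k)) ?iota_uniq//=.
  by rewrite eqxx lerDl sumr_ge0// => a _; case: ifP.
under eq_bigr do rewrite big_mkcond; rewrite exchange_big/=.
rewrite big_seq [leRHS]big_seq; apply: ler_sum => a; rewrite mem_index_iota => /andP[a0 aq].
rewrite -big_mkcond/= big_const_seq iter_addr_0 mulr_natl ler_wpMn2l// -size_filter.
apply: (@leq_trans (size [seq (b * (q %/ a))%N | b <- iota 1 a])); last first.
  by rewrite size_map size_iota.
apply: uniq_leq_size; first by rewrite filter_uniq// iota_uniq.
move=> k; rewrite mem_filter mem_index_iota => /andP[/eqP Ak /andP[k0 kq]].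
have gE : (q %/ a)%N = gcdn q k by rewrite -{1}(AE k) Ak mulKn.
apply/mapP; exists (k %/ gcdn q k)%N; last by rewrite gE divnK// dvdn_gcdr.
have g0 : (0 < gcdn q k)%N by rewrite gcdn_gt0 q0.
rewrite mem_iota add1n ltnS divn_gt0// dvdn_leq ?dvdn_gcdr//=.
by rewrite -Ak /A leq_div2r// -ltnS.
Qed.

(** Summability in [k] needs the first exponent to exceed 1 and the second to exceed 2, because a
    reduced denominator [a] can occur [a] times. *)
Definition gcd_weight (q k : nat) : R :=
  k%:R `^ (- (7 / 6)) + (q %/ gcdn q k)%N%:R `^ (- (7 / 3)).

Lemma gcd_weight_ge0 q k : 0 <= gcd_weight q k.
Proof. by rewrite addr_ge0 ?powR_ge0. Qed.

Lemma sum_gcd_weight_le q : (0 < q)%N -> \sum_(1 <= k < q.+1) gcd_weight q k <= 11.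
Proof.
move=> q0; rewrite big_split/=.
have H1 := @powRN_series_le R 6^-1 q (ltac:(by rewrite invr_gt0)).
have H2 := @powRN_series_le R 3^-1 q (ltac:(by rewrite invr_gt0)).
rewrite -(_ : (1 + 6^-1^-1) + (1 + 3^-1^-1) = 11); last by rewrite !invrK; lra.
apply: lerD.
  apply: le_trans H1; rewrite big_add1/=; apply: ler_sum => k _.
  by rewrite (_ : 7 / 6 = 1 + 6^-1 :> R)//; field.
have h0 a : 0 <= a%:R `^ (- (7 / 3)) :> R by exact: powR_ge0.
apply: (le_trans (sum_reduced_den_le q0 h0)); apply: le_trans H2.
rewrite big_add1/=; apply: ler_sum => k _.
have k0 : 0 < k.+1%:R :> R by rewrite ltr0n.
rewrite (_ : - (1 + 3^-1) = 1 + - (7 / 3) :> R); last by field.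
by rewrite powRD ?(gt_eqF k0) ?implybT// powRr1// ltW.
Qed.

(* The exponents are those of the two cases a >= sqrt k and a <= sqrt k. *)
Lemma gcd_weight_ge q k : (0 < q)%N -> (0 < k)%N ->
  (q %/ gcdn q k)%N%:R^-1 * k%:R `^ (- (2 / 3)) <= gcd_weight q k.
Proof.
move=> q0 k0; rewrite /gcd_weight.
have : (0 < q %/ gcdn q k)%N by rewrite divn_gt0 ?gcdn_gt0 ?q0// dvdn_leq ?dvdn_gcdl.
move: (q %/ gcdn q k)%N => a a0.
have kR : 0 < k%:R :> R by rewrite ltr0n.
have aR : 0 < a%:R :> R by rewrite ltr0n.
have aV : a%:R^-1 = a%:R `^ (-1) :> R by rewrite powR_inv1// ltW.
have [H|H] := leP (k%:R `^ 2^-1) (a%:R : R).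
  apply: ler_wpDr; first exact: powR_ge0.
  rewrite (_ : - (7 / 6) = - 2^-1 + - (2 / 3) :> R); last by field.
  rewrite powRD ?(gt_eqF kR) ?implybT// ler_wpM2r ?powR_ge0// powRN.
  by rewrite lef_pV2// posrE// powR_gt0.
apply: ler_wpDl; first exact: powR_ge0.
rewrite (_ : - (7 / 3) = -1 + - (4 / 3) :> R); last by field.
rewrite powRD ?(gt_eqF aR) ?implybT// aV ler_wpM2l ?powR_ge0// !powRN.
rewrite lef_pV2 ?posrE ?powR_gt0//.
have -> : (k%:R : R) `^ (2 / 3) = (k%:R `^ 2^-1) `^ (4 / 3).
  by rewrite -powRrM; congr (_ `^ _); field.
by rewrite ge0_ler_powR ?nnegrE ?powR_ge0// ltW.
Qed.

(** Every mixed term of the binomial expansion lies below the sum of the two extreme ones,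
    [h * x ^+ m] and [h ^+ m.+1]. *)
Lemma exprD_le (m : nat) : exists2 K : R, 0 <= K & forall x h : R, 0 <= x -> 0 <= h ->
  (x + h) ^+ m.+1 <= x ^+ m.+1 + K * (h * x ^+ m + h ^+ m.+1).
Proof.
elim: m => [|m [K K0 IH]].
  by exists 1 => // x h x0 h0; rewrite !expr1 expr0 !mul1r mulr1; lra.
(* One [h * x ^+ m.+1] comes from the main term; the product by [x + h] creates [K] times one such
   term and two mixed ones, each bounded by both extremes. *)
exists (1 + 3 * K) => [|x h x0 h0]; first by lra.
have xm : 0 <= x ^+ m by rewrite exprn_ge0.
have hm : 0 <= h ^+ m by rewrite exprn_ge0.
rewrite exprS; apply: (le_trans (ler_wpM2l (addr_ge0 x0 h0) (IH x h x0 h0))).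
rewrite !exprS.
have H1 : h * h * x ^+ m <= h * (x * x ^+ m) + h * (h * h ^+ m).
  have [hx|xh] := leP h x.
    rewrite -[leLHS]addr0 lerD ?mulr_ge0// -mulrA ler_wpM2l// ler_wpM2r//.
  rewrite -[leLHS]add0r lerD ?mulr_ge0// -mulrA ler_wpM2l// ler_wpM2l//.
  by rewrite lerXn2r// ?nnegrE// ltW.
have H2 : x * (h * h ^+ m) <= h * (x * x ^+ m) + h * (h * h ^+ m).
  have [hx|xh] := leP h x.
    rewrite -[leLHS]addr0 lerD ?mulr_ge0// mulrCA ler_wpM2l// ler_wpM2l//.
    by rewrite lerXn2r.
  by rewrite -[leLHS]add0r lerD ?mulr_ge0// ler_wpM2r ?mulr_ge0// ltW.
have H3 : 0 <= h * (h * h ^+ m) by rewrite !mulr_ge0.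
have H4 := ler_wpM2l K0 H1; have H5 := ler_wpM2l K0 H2.
have H6 := mulr_ge0 K0 H3.
have H7 : 0 <= K * (h * (x * x ^+ m)) by rewrite !mulr_ge0.
move: (x ^+ m) (h ^+ m) xm hm H1 H2 H3 H4 H5 H6 H7 => X Y *; lra.
Qed.

End GcdSums.

(** * From correlations to the variance of a sum *)

Section Variance.
Context d (X : measurableType d) (R : realType) (mu : {measure set X -> \bar R}).
Variables (D : set X) (F : nat -> X -> R) (kappa K E : R) (e : nat -> nat -> R).
Hypothesis mD : measurable D.
Hypothesis muD : mu D = 1%E.
Hypothesis mF : forall q, measurable_fun D (F q).
Hypothesis F0 : forall q x, 0 <= F q x.
Hypothesis kappa0 : 0 <= kappa.
Hypothesis K0 : 0 <= K.
Hypothesis e0 : forall q k, 0 <= e q k.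
Hypothesis F_mean : forall q, (0 < q)%N ->
  (\int[mu]_(x in D) (F q x)%:E = (kappa / q%:R)%:E)%E.
Hypothesis F_corr : forall q k, (0 < k <= q)%N ->
  (\int[mu]_(x in D) (F q x * F k x)%:E <=
    (kappa / q%:R * (kappa / k%:R) + K / q%:R * e q k)%:E)%E.
Hypothesis e_sum : forall q, (0 < q)%N -> \sum_(1 <= k < q.+1) e q k <= E.

(** The correlation bound exists for [k <= q] only, so it is symmetrised as [A q k + A k q]. This
    counts the diagonal twice and produces the factor 2. *)
Lemma integral_sum_sq_le u v : (0 < u)%N ->
  (\int[mu]_(x in D) ((\sum_(u <= q < v) F q x) ^+ 2)%:E <=
  ((\sum_(u <= q < v) kappa / q%:R) ^+ 2 + 2 * K * E * \sum_(u <= q < v) q%:R^-1)%:E)%E.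
Proof.
move=> u0; pose A q k : R := if (k <= q)%N then K / q%:R * e q k else 0.
have A0 q k : 0 <= A q k by rewrite /A; case: ifP => // _; rewrite mulr_ge0// divr_ge0.
have mFF q k : measurable_fun D (fun x => (F q x * F k x)%:E).
  by apply/measurable_EFinP; exact: measurable_funM.
have FF0 q k x : (0 <= (F q x * F k x)%:E)%E by rewrite lee_fin mulr_ge0.
have corr q k : (0 < q)%N -> (0 < k)%N -> (\int[mu]_(x in D) (F q x * F k x)%:E <=
    (kappa / q%:R * (kappa / k%:R) + (A q k + A k q))%:E)%E.
  wlog kq : q k / (k <= q)%N => [H q0 k0|q0 k0].
    have [/H|/ltnW/H] := leqP k q; first exact.
    move=> /(_ k0 q0); under eq_integral do rewrite mulrC.
    by rewrite mulrC [A k q + _]addrC.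
  apply: le_trans (F_corr _) _; first by rewrite k0.
  by rewrite lee_fin lerD2l {1}/A kq lerDl.
have -> : (\int[mu]_(x in D) ((\sum_(u <= q < v) F q x) ^+ 2)%:E =
    \sum_(u <= q < v) \sum_(u <= k < v) \int[mu]_(x in D) (F q x * F k x)%:E)%E.
  transitivity (\int[mu]_(x in D) \sum_(u <= q < v) \sum_(u <= k < v) (F q x * F k x)%:E)%E.
    apply: eq_integral => x _; rewrite expr2 big_distrlr/= -sumEFin.
    by apply: eq_bigr => q _; rewrite sumEFin.
  rewrite ge0_integral_sum//; last 2 first.
  - by move=> q; exact: emeasurable_sum.
  - by move=> q x _; exact: sume_ge0.
  by apply: eq_bigr => q _; rewrite ge0_integral_sum.
apply: (@le_trans _ _ (\sum_(u <= q < v) \sum_(u <= k < v)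
    (kappa / q%:R * (kappa / k%:R) + (A q k + A k q))%:E)%E).
  rewrite big_nat [leRHS]big_nat; apply: lee_sum => q /andP[uq _].
  rewrite big_nat [leRHS]big_nat; apply: lee_sum => k /andP[uk _].
  by apply: corr; apply: leq_trans u0 _.
under eq_bigr do rewrite sumEFin; rewrite sumEFin lee_fin.
under eq_bigr do rewrite big_split/=; rewrite big_split/= lerD//.
  by rewrite expr2 big_distrlr.
under eq_bigr do rewrite big_split/=; rewrite big_split/= [X in _ + X]exchange_big/=.
rewrite -mulr2n -[leLHS]mulr_natl -!mulrA ler_wpM2l//.
suff H q : (0 < q)%N -> \sum_(u <= k < v) A q k <= K * (E * q%:R^-1).
  rewrite !mulr_sumr big_nat [leRHS]big_nat; apply: ler_sum => q /andP[uq _].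
  by apply: H; apply: leq_trans u0 _.
move=> q0; apply: (@le_trans _ _ (K / q%:R * \sum_(1 <= k < q.+1) e q k)); last first.
  rewrite [leRHS](_ : _ = K / q%:R * E); last by ring.
  by rewrite ler_wpM2l ?e_sum// divr_ge0.
rewrite /A -big_mkcond/= mulr_sumr.
have f0 k : 0 <= K / q%:R * e q k by rewrite mulr_ge0// divr_ge0.
rewrite (big_nat_widen u v (maxn v q.+1)) ?leq_maxl// (big_nat_widenl u 1)//=.
rewrite [leRHS](big_nat_widen 1 q.+1 (maxn v q.+1) xpredT) ?leq_maxr//.
rewrite big_mkcond [leRHS]big_mkcond/=; apply: ler_sum => k _.
by rewrite ltnS; case: (k <= q)%N => //=; case: ifP.
Qed.

Lemma integral_sum_deviation_sq_le u v : (0 < u)%N ->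
  (\int[mu]_(x in D) ((\sum_(u <= q < v) (F q x - kappa / q%:R)) ^+ 2)%:E <=
  (2 * K * E * \sum_(u <= q < v) q%:R^-1)%:E)%E.
Proof.
move=> u0; set M := \sum_(u <= q < v) kappa / q%:R.
have M0 : 0 <= M by rewrite sumr_ge0// => q _; rewrite divr_ge0.
pose S x := \sum_(u <= q < v) F q x.
have mS : measurable_fun D S by exact: measurable_sum.
have S0 x : 0 <= S x by rewrite sumr_ge0.
have S_mean : (\int[mu]_(x in D) (S x)%:E = M%:E)%E.
  under eq_integral do rewrite /S -sumEFin.
  rewrite ge0_integral_sum//; last 2 first.
  - by move=> q; exact/measurable_EFinP.
  - by move=> q x _; rewrite lee_fin.
  rewrite /M -sumEFin big_nat [RHS]big_nat; apply: eq_bigr => q /andP[uq _].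
  by apply: F_mean; apply: leq_trans u0 _.
have mMS : measurable_fun D (fun x => (2 * M * S x)%:E).
  by apply/measurable_EFinP; apply: measurable_funM; first exact: measurable_cst.
have mdev : measurable_fun D (fun x => ((S x - M) ^+ 2)%:E).
  apply/measurable_EFinP; apply: measurable_funX; apply: measurable_funB => //.
(* Writing the variance identity without subtraction keeps all integrands nonnegative. *)
have key : (\int[mu]_(x in D) ((S x - M) ^+ 2)%:E + (2 * M * M)%:E =
    \int[mu]_(x in D) ((S x) ^+ 2)%:E + (M ^+ 2)%:E)%E.
  have -> : ((2 * M * M)%:E = \int[mu]_(x in D) (2 * M * S x)%:E)%E.
    under [RHS]eq_integral do rewrite EFinM; rewrite ge0_integralZl_EFin//; last 3 first.
    - by move=> x _; rewrite lee_fin.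
    - exact/measurable_EFinP.
    - by rewrite mulr_ge0.
    by rewrite S_mean -EFinM.
  have -> : ((M ^+ 2)%:E = \int[mu]_(x in D) cst (M ^+ 2)%:E x)%E.
    by rewrite integral_cst// [X in (_ * X)%E](_ : _ = 1%E) ?mule1.
  rewrite -!ge0_integralD//.
  - by apply: eq_integral => x _ /=; rewrite -!EFinD; congr EFin; ring.
  - by move=> x _; rewrite lee_fin sqr_ge0.
  - by apply/measurable_EFinP; exact: measurable_funX.
  - by move=> x _; rewrite lee_fin sqr_ge0.
  - by move=> x _; rewrite lee_fin sqr_ge0.
  - by move=> x _; rewrite lee_fin !mulr_ge0.
have -> : (\int[mu]_(x in D) ((\sum_(u <= q < v) (F q x - kappa / q%:R)) ^+ 2)%:E =
    \int[mu]_(x in D) ((S x - M) ^+ 2)%:E)%E.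
  by apply: eq_integral => x _; rewrite /S /M -sumrB.
rewrite -(@leeD2rE _ (2 * M * M)%:E)// key.
have := integral_sum_sq_le v u0; rewrite -/M => H.
apply: (le_trans (leeD2r _ H)).
by rewrite -!EFinD lee_fin le_eqVlt; apply/orP; left; apply/eqP; ring.
Qed.

End Variance.

(** * From dyadic blocks to a logarithmic asymptotic formula *)

Section LogAsymptotics.
Context (R : realType).
Implicit Types (f : nat -> R).

Lemma ln2_bounds : (2^-1 <= ln 2 :> R) /\ (ln 2 <= 1 :> R).
Proof.
split; last by rewrite (_ : 2 = 1 + 1 :> R) ?le_ln1Dx//; lra.
have : ln (1 - 2^-1) <= - 2^-1 :> R by rewrite le_ln1Dx//; lra.
have -> : 1 - 2^-1 = 2^-1 :> R by lra.
by rewrite lnV ?posrE// lerN2.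
Qed.

Lemma harmonic_ln_bounds (M : nat) : (0 < M)%N ->
  ln (M%:R : R) <= \sum_(1 <= q < M) q%:R^-1 <= 1 + ln (M%:R : R).
Proof.
move=> M0; apply/andP; split.
  case: M M0 => // M _; elim: M => [|M IH]; first by rewrite ln1 big_geq.
  rewrite big_nat_recr//=.
  have M0 : 0 < M.+1%:R :> R by rewrite ltr0n.
  have -> : M.+2%:R = M.+1%:R * (1 + M.+1%:R^-1) :> R.
    by rewrite mulrDr mulr1 divff ?gt_eqF// natr1.
  rewrite lnM ?posrE ?addr_gt0 ?invr_gt0// lerD// le_ln1Dx//.
  by rewrite (lt_trans (ltrN10 R))// invr_gt0.
apply: (@le_trans _ _ (\sum_(1 <= q < M.+1) q%:R^-1)).
  by rewrite big_nat_recr//= lerDl invr_ge0.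
case: M M0 => // M _; elim: M => [|M IH]; first by rewrite big_nat1 invr1 ln1 addr0.
rewrite big_nat_recr//=; apply: (le_trans (lerD IH (lexx _))).
rewrite -addrA lerD2l -lerBrDl -lerN2 opprB.
have M0 : 0 < M.+2%:R :> R by rewrite ltr0n.
have -> : M.+1%:R = M.+2%:R * (1 - M.+2%:R^-1) :> R.
  by rewrite mulrBr mulr1 divff ?gt_eqF// -[M.+2%:R]natr1 addrK.
have M1 : M.+2%:R^-1 < 1 :> R by rewrite invf_lt1// ltr1n.
rewrite lnM ?posrE ?subr_gt0// addrAC subrr add0r le_ln1Dx//.
by rewrite ltrN2.
Qed.

Lemma sum_dyadic_blocks f a j :
  \sum_(a <= k < a + j) \sum_(2 ^ k <= q < 2 ^ k.+1) f q =
  \sum_(2 ^ a <= q < 2 ^ (a + j)) f q.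
Proof.
elim: j => [|j IH]; first by rewrite !addn0 !big_geq.
rewrite addnS big_nat_recr ?leq_addr//= IH -big_cat_nat//=.
  by rewrite leq_exp2l// leq_addr.
by rewrite leq_exp2l.
Qed.

(** Each block has harmonic sum at most 1. Hence the variance of [j] consecutive blocks is linear in
    [j], as the dyadic argument requires. *)
Lemma sum_dyadic_blocks_inv_le a j :
  \sum_(2 ^ a <= q < 2 ^ (a + j)) q%:R^-1 <= j%:R :> R.
Proof.
rewrite -sum_dyadic_blocks.
apply: (@le_trans _ _ (\sum_(a <= k < a + j) 1)); last by rewrite sumr_const_nat addKn.
apply: ler_sum => k _; have k0 : 0 < (2 ^ k)%:R :> R by rewrite ltr0n expn_gt0.
apply: (@le_trans _ _ (\sum_(2 ^ k <= q < 2 ^ k.+1) (2 ^ k)%:R^-1)).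
  rewrite big_nat [leRHS]big_nat; apply: ler_sum => q /andP[kq _].
  have kqR : (2 ^ k)%:R <= q%:R :> R by rewrite ler_nat.
  by rewrite lef_pV2// posrE// (lt_le_trans k0).
rewrite sumr_const_nat expnS mul2n -addnn addnK -[_ *+ (2 ^ k)]mulr_natr.
by rewrite mulVf// gt_eqF.
Qed.

(** Nonnegativity of [f] makes its sums monotone, so [N] is squeezed between consecutive powers of
    2; the harmonic sums there differ from [ln N] by at most 2. *)
Lemma log_asymptotics f (kappa A eps : R) : 0 <= kappa -> 0 < eps -> (forall q, 0 <= f q) ->
  (forall m j, (j <= 2 ^ m)%N ->
    (\sum_(0 <= k < j) \sum_(2 ^ k <= q < 2 ^ k.+1) (f q - kappa / q%:R)) ^+ 2 <=
      A * 2 ^+ m * m.+1%:R `^ (3 + 2 * eps)) ->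
  exists K : R, forall N : nat, 1 <= ln (ln (N%:R : R)) ->
    `|\sum_(1 <= q < N.+1) f q - kappa * ln N%:R| <=
      K * (ln N%:R `^ 2^-1 * ln (ln N%:R) `^ (3 / 2 + eps)).
Proof.
move=> kappa0 eps0 f0 HA.
(* The constants 6 and 8 come from [2 ^+ m <= 6 * L] and [m.+1 <= 8 * l] below. *)
pose c := Num.sqrt (6 * `|A| * 8 `^ (3 + 2 * eps)).
exists (c + 2 * kappa) => N; set L := ln N%:R; set l := ln L => l1.
have [ln2a ln2b] := ln2_bounds.
have ln2p : 0 < ln 2 :> R by rewrite (lt_le_trans _ ln2a)// invr_gt0.
(* As [ln] is 0 off the positive reals, [l <= 0] for every [L < 1]; the hypothesis therefore also
   excludes [N = 0]. *)
have L1 : 1 <= L.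
  have [//|L1] := leP 1 L; have : l <= 0 by rewrite ln_le0// ltW.
  by move: l1; lra.
have L0 : 0 < L by lra.
have N0 : (0 < N)%N.
  by case: N @L @l l1 L1 L0 => // L l _; rewrite /L ln0 ?ltxx//; lra.
pose h := L `^ 2^-1 * l `^ (3 / 2 + eps).
have h1 : 1 <= h.
  rewrite -[1]mulr1 ler_pM//.
    apply: (@le_trans _ _ (1 `^ 2^-1)); first by rewrite powR1.
    by rewrite ge0_ler_powR ?nnegrE//; lra.
  apply: (@le_trans _ _ (1 `^ (3 / 2 + eps))); first by rewrite powR1.
  by rewrite ge0_ler_powR ?nnegrE//; lra.
have h2 : h ^+ 2 = L * l `^ (3 + 2 * eps).
  rewrite /h exprMn -!powR_mulrn ?powR_ge0// -!powRrM mulVf// powRr1 ?ltW//.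
  by congr (_ * _ `^ _); field.
(* There are [j] complete blocks up to [N], and [m] is the least scale that covers [j.+1] of
   them. *)
pose j := trunc_log 2 N; pose m := up_log 2 j.+1.
have /andP[jN Nj] : (2 ^ j <= N < 2 ^ j.+1)%N by apply: trunc_log_bounds.
have ln2n i : ln ((2 ^ i)%:R : R) = i%:R * ln 2.
  by rewrite natrX lnXn// mulr_natl.
have jL : j%:R * ln 2 <= L by rewrite -ln2n ler_ln ?posrE ?ltr0n ?expn_gt0// ler_nat.
have Lj : L <= j.+1%:R * ln 2.
  by rewrite -ln2n ler_ln ?posrE ?ltr0n ?expn_gt0// ler_nat ltnW.
have j0 : (0 < j)%N.
  rewrite lt0n; apply/eqP => j0; move: Lj; rewrite j0 mul1r => H.
  suff : l <= 0 by lra.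
  by rewrite ln_le0// (le_trans H).
have jL2 : j.+1%:R <= 3 * L.
  have : j%:R * 2^-1 <= j%:R * ln 2 :> R by rewrite ler_wpM2l.
  by rewrite -[j.+1%:R]natr1; lra.
have jm : (j.+1 <= 2 ^ m)%N by exact: up_logP.
have mj : (2 ^ m.-1 < j.+1)%N by apply: up_log_gtn.
have m0 : (0 < m)%N by rewrite up_log_gt0.
have m6 : 2 ^+ m <= 6 * L.
  rewrite -(prednK m0) exprS; have : (2 ^ m.-1)%:R <= j.+1%:R :> R by rewrite ler_nat ltnW.
  by rewrite natrX; lra.
have ml : m.+1%:R <= 8 * l.
  have : ln ((2 ^ m.-1)%:R : R) <= ln (3 * L).
    rewrite ler_ln ?posrE ?ltr0n ?expn_gt0//; last by lra.
    by rewrite (le_trans _ jL2)// ler_nat ltnW.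
  rewrite ln2n lnM ?posrE// -/l.
  have : ln 3 <= 2 :> R by rewrite (_ : 3 = 1 + 2 :> R) ?le_ln1Dx//; lra.
  have : m.-1%:R * 2^-1 <= m.-1%:R * ln 2 :> R by rewrite ler_wpM2l.
  have -> : m.+1%:R = m.-1%:R + 2 :> R by rewrite -natrD addn2 prednK.
  by lra.
have dev i : (i <= j.+1)%N ->
    `|\sum_(1 <= q < 2 ^ i) f q - kappa * \sum_(1 <= q < 2 ^ i) q%:R^-1| <= c * h.
  move=> ij; rewrite mulr_sumr -sumrB -[i](add0n i) -(sum_dyadic_blocks _ 0).
  have := HA m i (leq_trans ij jm); set S := \sum_(0 <= k < i) _ => HS.
  rewrite -sqrtr_sqr -(ger0_norm (_ : 0 <= c * h)); last first.
    by rewrite mulr_ge0 ?sqrtr_ge0// (le_trans ler01).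
  rewrite -sqrtr_sqr ler_wsqrtr//; apply: (le_trans HS).
  rewrite exprMn sqr_sqrtr; last by rewrite !mulr_ge0 ?powR_ge0.
  have P8 : (8 * l) `^ (3 + 2 * eps) = 8 `^ (3 + 2 * eps) * l `^ (3 + 2 * eps).
    by rewrite powRM//; lra.
  rewrite h2 [leRHS](_ : _ = `|A| * (6 * L * (8 * l) `^ (3 + 2 * eps))); last first.
    by rewrite P8; ring.
  rewrite -mulrA; apply: (@le_trans _ _ (`|A| * (2 ^+ m * m.+1%:R `^ (3 + 2 * eps)))).
    by rewrite ler_wpM2r ?ler_norm// mulr_ge0 ?powR_ge0// exprn_ge0.
  rewrite ler_wpM2l// ler_pM ?powR_ge0 ?exprn_ge0//.
  by rewrite ge0_ler_powR ?nnegrE//; lra.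
have sumf i i' : (0 < i <= i')%N -> \sum_(1 <= q < i) f q <= \sum_(1 <= q < i') f q.
  move=> /andP[i0 ii']; rewrite [leRHS](big_cat_nat (n := i))//=.
  by rewrite lerDl sumr_ge0.
have S1 := sumf (2 ^ j)%N N.+1; have S2 := sumf N.+1 (2 ^ j.+1)%N.
have {}S1 := S1 (ltac:(by rewrite expn_gt0/= ltnW)).
have {}S2 := S2 (ltac:(by [])).
have d1 := dev j (leqnSn j); have d2 := dev j.+1 (leqnn _).
have /andP[h1a h1b] := @harmonic_ln_bounds (2 ^ j)%N (ltac:(by rewrite expn_gt0)).
have /andP[h2a h2b] := @harmonic_ln_bounds (2 ^ j.+1)%N (ltac:(by rewrite expn_gt0)).
rewrite !ln2n in h1a h1b h2a h2b.
have k1 : kappa * L - 2 * kappa <= kappa * \sum_(1 <= q < 2 ^ j) q%:R^-1.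
  rewrite mulrC [2 * _]mulrC [kappa * 2]mulrC -mulrBl mulrC ler_wpM2l//.
  by move: Lj h1a; rewrite -[j.+1%:R]natr1; lra.
have k2 : kappa * \sum_(1 <= q < 2 ^ j.+1) q%:R^-1 <= kappa * L + 2 * kappa.
  rewrite mulrC -[kappa * L]mulrC -mulrDl mulrC [leRHS]mulrC ler_wpM2l//.
  by move: jL h2b; rewrite -[j.+1%:R]natr1; lra.
have k3 : 2 * kappa <= 2 * kappa * h by rewrite ler_peMr// mulr_ge0.
rewrite -/h mulrDl ler_norml; move: d1 d2; rewrite !ler_norml.
by move=> /andP[d1 _] /andP[_ d2]; apply/andP; split; lra.
Qed.

End LogAsymptotics.

(** * The number of solutions as a sum of counts *)

Section Solutions.
Context (R : realType) (n s : nat) (G : rational_carnot R n s).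
Variable lam : nat -> R.
Hypothesis lam_gt0 : forall i, (1 <= i <= s)%N -> 0 < lam i.
Implicit Types g p : 'rV[R]_n.

Local Notation Gamma := (@integral_points R n).
Local Notation Q := (hausdorff_dim G).

Definition approx_radius (C : R) (q : nat) : R := C * q%:R `^ (- (Q.+1%:R / Q%:R)).

Lemma approx_radius_ge0 C q : 0 <= C -> 0 <= approx_radius C q.
Proof. by move=> C0; rewrite mulr_ge0// powR_ge0. Qed.

(** The exponent (Q + 1) / Q is calibrated so that the mean [q^Q * B * rho^Q] becomes
    [B C^Q / q]. *)
Lemma approx_radiusX C q : (0 < Q)%N -> (0 < q)%N ->
  approx_radius C q ^+ Q = C ^+ Q / q%:R ^+ Q.+1.
Proof.
move=> Q0 q0; have Qn0 : Q%:R != 0 :> R by rewrite pnatr_eq0 -lt0n.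
rewrite exprMn; congr (_ * _).
by rewrite -powR_mulrn ?powR_ge0// -powRrM mulNr mulfVK// powRN powR_mulrn.
Qed.

Local Open Scope ereal_scope.

Lemma esum_card (T : choiceType) (A : set T) : finite_set A ->
  \esum_(i in A) 1 = #|` fset_set A|%:R%:E :> \bar R.
Proof.
move=> fA; rewrite esum_fset// fsbig_finite//= sume_const_seq//.
by rewrite mule1.
Qed.

Lemma nb_solutionsE C g N : (nb_solutions G lam C g N)%:R%:E =
  \sum_(1 <= q < N.+1) approx_count G lam q (approx_radius C q) g :> \bar R.
Proof.
rewrite /nb_solutions -esum_card; last exact: finite_solutions.
rewrite -esum_seq ?iota_uniq//; last by move=> q; exact: approx_count_ge0.
rewrite /approx_count esum_esum; last by move=> *; exact: ball_indic_ge0.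
pose S' := ([set` index_iota 1 N.+1] `*`` (fun=> Gamma)) `&`
  [set k : nat * 'rV[R]_n | (wnorm G lam (cmul G (- g) (dil G k.1%:R^-1 k.2)) <=
    approx_radius C k.1)%R].
have bij : set_bij S' (solutions G lam C g N) (fun k => (k.2, k.1)).
  split=> [[q p] [[/= qN pZ] H]|[q p] [q' p'] _ _ [-> ->]//|[p q] [pZ qN H]].
    by move: qN; rewrite mem_index_iota ltnS => qN; split.
  by exists (q, p) => //; split=> //; split=> //=; rewrite mem_index_iota ltnS.
apply: (etrans (reindex_esum _ _ _ (fun=> 1) bij)); rewrite esum_mkcondr.
apply: eq_esum => -[q p] _; rewrite ball_indicE.
case: ifPn => [|]; first by rewrite in_setE /= => ->.
by rewrite notin_setE /= => /negP/negbTE ->.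
Qed.

End Solutions.

(** * Variance of the counts and the almost everywhere statement *)

Section Asymptotics.
Context (R : realType) (n s : nat) (G : rational_carnot R n s).
Variables (lam : nat -> R) (C : R).
Hypothesis lam_gt0 : forall i, (1 <= i <= s)%N -> 0 < lam i.
Hypothesis wdist_triangle : forall x y z : 'rV[R]_n,
  wdist G lam x z <= wdist G lam x y + wdist G lam y z.
Hypothesis dim_ge3 : (3 <= hausdorff_dim G)%N.
Hypothesis C0 : 0 <= C.

Local Notation leb := (lebesgue_rV R n).
Local Notation Gamma := (@integral_points R n).
Local Notation K := (@unit_cell R n).
Local Notation Q := (hausdorff_dim G).
Local Notation B := (unit_ball_volume G lam).
Local Notation rho := (approx_radius G C).

Let Q0 : (0 < Q)%N. Proof. by apply: leq_trans dim_ge3. Qed.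

Let B0 : 0 <= B. Proof. exact/ltW/unit_ball_volume_gt0. Qed.

Definition real_count (q : nat) (x : 'rV[R]_n) : R := fine (approx_count G lam q (rho q) x).

Lemma real_count_ge0 q x : 0 <= real_count q x.
Proof. by rewrite fine_ge0// approx_count_ge0. Qed.

Lemma real_countE q x : (0 < q)%N -> (real_count q x)%:E = approx_count G lam q (rho q) x.
Proof.
move=> q0; rewrite fineK//.
have [D D0 [fin _]] := approx_count_correlation lam_gt0 wdist_triangle.
by apply: fin => //; exact: approx_radius_ge0.
Qed.

Lemma measurable_real_count q : measurable_fun K (real_count q).
Proof.
apply: (@measurable_funS _ _ _ _ setT) => //.
exact: measurableT_comp (fine_measurable _) (measurable_approx_count G lam_gt0 q (rho q)).
Qed.

Lemma real_count_mean q : (0 < q)%N ->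
  (\int[leb]_(x in K) (real_count q x)%:E = (B * C ^+ Q / q%:R)%:E)%E.
Proof.
move=> q0; have qR : q%:R != 0 :> R by rewrite pnatr_eq0 -lt0n.
under eq_integral do rewrite real_countE//.
rewrite mean_approx_count//; last exact: approx_radius_ge0.
rewrite approx_radiusX// exprSr; congr EFin; field.
by rewrite expf_neq0 ?qR.
Qed.

Let gcd_weight_powR q k : (0 < q)%N -> (0 < k)%N ->
  ((q %/ gcdn q k)%N%:R : R)^-1 ^+ Q <= gcd_weight R q k.
Proof.
move=> q0 k0; apply: ler_wpDl; first exact: powR_ge0.
have a0 : (0 < q %/ gcdn q k)%N by rewrite divn_gt0 ?gcdn_gt0 ?q0// dvdn_leq ?dvdn_gcdl.
rewrite exprVn -powR_invn ?ler0n//; apply: ler_powR; first by rewrite ler1n.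
rewrite lerN2; apply: (@le_trans _ _ 3); first by lra.
by rewrite ler_nat.
Qed.

(** Here [k * rho k = C k^(-1/Q)], and its power Q - 1 decays like [k^(-(1 - 1/Q))], where
    [1 - 1/Q >= 2/3]. *)
Let powR_radius k : (0 < k)%N ->
  (k%:R * rho k) ^+ Q.-1 <= C ^+ Q.-1 * k%:R `^ (- (2 / 3)).
Proof.
move=> k0; have k1 : 1 <= k%:R :> R by rewrite ler1n.
have kR : 0 < k%:R :> R by rewrite ltr0n.
have QR : 3 <= Q%:R :> R by rewrite ler_nat.
have Q1 : Q.-1%:R = Q%:R - 1 :> R by rewrite -subn1 natrB.
have -> : k%:R * rho k = C * k%:R `^ (- Q%:R^-1).
  rewrite /approx_radius mulrCA; congr (_ * _).
  rewrite -{1}(powRr1 (ltW kR)) -powRD; last by rewrite (gt_eqF kR) implybT.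
  congr (_ `^ _); rewrite -natr1; field; lra.
rewrite exprMn ler_wpM2l ?exprn_ge0// -powR_mulrn ?powR_ge0// -powRrM.
apply: ler_powR => //; rewrite mulNr lerN2 Q1 mulrBr mulr1 mulVf; last by lra.
have : Q%:R^-1 <= 3^-1 :> R by rewrite lef_pV2// posrE; lra.
by lra.
Qed.

Lemma real_count_corr : exists2 K' : R, 0 <= K' & forall q k, (0 < k <= q)%N ->
  (\int[leb]_(x in K) (real_count q x * real_count k x)%:E <=
    (B * C ^+ Q / q%:R * (B * C ^+ Q / k%:R) + K' / q%:R * gcd_weight R q k)%:E)%E.
Proof.
have [D D0 [_ corr]] := approx_count_correlation lam_gt0 wdist_triangle.
have [K1 K10 HK1] := exprD_le R Q.-1.
exists (B * C ^+ Q * B * K1 * (D * C ^+ Q.-1 + D ^+ Q)).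
  by rewrite !mulr_ge0 ?exprn_ge0// addr_ge0 ?mulr_ge0 ?exprn_ge0.
move=> q k /andP[k0 kq]; have q0 := leq_trans k0 kq.
under eq_integral do rewrite EFinM !real_countE//.
apply: (le_trans (corr _ _ _ _ q0 k0 (approx_radius_ge0 G q C0) (approx_radius_ge0 G k C0))).
rewrite lee_fin.
set d := gcdn q k; have d0 : (0 < d)%N by rewrite gcdn_gt0 q0.
pose a := (q %/ d)%N; have qE : q = (a * d)%N by rewrite divnK// dvdn_gcdl.
have kE : k = (k %/ d * d)%N by rewrite divnK// dvdn_gcdr.
have a0 : (0 < a)%N by move: q0; rewrite qE muln_gt0 => /andP[].
have aR : a%:R != 0 :> R by rewrite pnatr_eq0 -lt0n.
have dR : d%:R != 0 :> R by rewrite pnatr_eq0 -lt0n.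
have qR : q%:R != 0 :> R by rewrite pnatr_eq0 -lt0n.
have kR : k%:R != 0 :> R by rewrite pnatr_eq0 -lt0n.
(* Pulling [a] out of the radius [L * rho k + D] leaves [r + h]; the powers of [a] and [d] then
   cancel against [q^Q]. The term [r ^+ Q = C^Q / k] gives the product of the means. *)
pose r := k%:R * rho k; pose h := D * a%:R^-1.
have r0 : 0 <= r by rewrite mulr_ge0// approx_radius_ge0.
have h0 : 0 <= h by rewrite mulr_ge0.
have -> : (q * (k %/ d))%:R * rho k + D = a%:R * (r + h).
  rewrite /r /h mulrDr; congr (_ + _); last by rewrite mulrCA divff ?mulr1.
  rewrite mulrA; congr (_ * _); rewrite -natrM; congr (_%:R).
  by rewrite {1}qE -mulnA [(d * _)%N]mulnC -kE.
have rX : r ^+ Q = C ^+ Q / k%:R.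
  by rewrite exprMn approx_radiusX// exprSr; field; rewrite ?expf_neq0 ?kR.
have -> : d%:R ^+ Q * (B * (a%:R * (r + h)) ^+ Q) * (B * rho q ^+ Q) =
    B * C ^+ Q / q%:R * (B * (r + h) ^+ Q).
  have qX : q%:R ^+ Q = a%:R ^+ Q * d%:R ^+ Q :> R by rewrite {1}qE natrM exprMn.
  rewrite approx_radiusX// exprSr qX exprMn; field.
  by rewrite qR !expf_neq0.
rewrite [leRHS](_ : _ = B * C ^+ Q / q%:R * (B * (C ^+ Q / k%:R +
    K1 * ((D * C ^+ Q.-1 + D ^+ Q) * gcd_weight R q k)))); last by ring.
rewrite -rX ler_wpM2l ?divr_ge0 ?mulr_ge0 ?exprn_ge0// ler_wpM2l//.
have := HK1 r h r0 h0; rewrite prednK// => /le_trans; apply.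
rewrite lerD2l ler_wpM2l// mulrDl lerD//.
  apply: (@le_trans _ _ (h * (C ^+ Q.-1 * k%:R `^ (- (2 / 3))))).
    by rewrite ler_wpM2l// powR_radius.
  rewrite (_ : h * _ = D * C ^+ Q.-1 * (a%:R^-1 * k%:R `^ (- (2 / 3)))).
    by rewrite ler_wpM2l ?mulr_ge0 ?exprn_ge0// gcd_weight_ge.
  by rewrite /h; ring.
by rewrite exprMn ler_wpM2l ?exprn_ge0// gcd_weight_powR.
Qed.

Lemma ae_unit_cell_asymptotics (eps : R) : 0 < eps ->
  {ae leb, forall g, K g -> exists A : R, forall N : nat, 1 <= ln (ln (N%:R : R)) ->
    `|(nb_solutions G lam C g N)%:R - B * C ^+ Q * ln N%:R| <=
      A * (ln N%:R `^ 2^-1 * ln (ln N%:R) `^ (3 / 2 + eps))}.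
Proof.
move=> eps0; have [K' K'0 corr] := real_count_corr.
have kappa0 : 0 <= B * C ^+ Q by rewrite mulr_ge0 ?exprn_ge0.
have mK := @measurable_unit_cell R n.
have nbE g N : (nb_solutions G lam C g N)%:R = \sum_(1 <= q < N.+1) real_count q g.
  apply: EFin_inj; rewrite nb_solutionsE// -sumEFin big_nat [RHS]big_nat.
  by apply: eq_bigr => q /andP[q0 _]; rewrite real_countE.
pose X (k : nat) (g : 'rV[R]_n) : R :=
  \sum_(2 ^ k <= q < 2 ^ k.+1) (real_count q g - B * C ^+ Q / q%:R).
have mX k : measurable_fun K (X k).
  apply: measurable_sum => q; apply: measurable_funB; last exact: measurable_cst.
  exact: measurable_real_count.
have varX a j : (\int[leb]_(g in K) ((\sum_(a <= k < a + j) X k g) ^+ 2)%:E <=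
    (2 * K' * 11 * j%:R)%:E)%E.
  under eq_integral do rewrite /X (sum_dyadic_blocks (fun q => real_count q _ - _)).
  apply: (le_trans (integral_sum_deviation_sq_le mK (lebesgue_unit_cell R n)
    measurable_real_count real_count_ge0 kappa0 K'0 (@gcd_weight_ge0 R) real_count_mean
    corr (@sum_gcd_weight_le R) _ _)); first by rewrite expn_gt0.
  by rewrite lee_fin ler_wpM2l ?mulr_ge0// sum_dyadic_blocks_inv_le.
(* The parameter is doubled because the square root halves the exponent [3 + 2 * eps]. *)
have := ae_sum_sq_le mK mX varX (ltac:(by rewrite mulr_gt0) : 0 < 2 * eps).
apply: filterS => g Hg Kg; have [A HA] := Hg Kg.
have [A' HA'] := log_asymptotics kappa0 eps0 (real_count_ge0 ^~ g) HA.
by exists A' => N Nl; rewrite nbE; exact: HA'.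
Qed.

Lemma nb_solutions_cmul p g N : Gamma p ->
  nb_solutions G lam C (cmul G p g) N = nb_solutions G lam C g N.
Proof.
move=> pZ; suff E : ((nb_solutions G lam C (cmul G p g) N)%:R%:E =
    (nb_solutions G lam C g N)%:R%:E :> \bar R)%E.
  by apply/eqP; rewrite -(eqr_nat R); apply/eqP/EFin_inj.
apply: (etrans (nb_solutionsE G lam_gt0 C _ N)).
apply: (etrans _ (esym (nb_solutionsE G lam_gt0 C g N))).
apply: eq_big_nat => q /andP[q0 _].
exact: (approx_count_cmul lam_gt0 wdist_triangle _ _ q0 pZ).
Qed.

(** Lattice translates of the cell cover the group, so the exceptional set lies in a countable union
    of translates of one null set. *)
Lemma ae_unit_cell_invariant (P : 'rV[R]_n -> Prop) :
  (forall p g, Gamma p -> P (cmul G p g) -> P g) ->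
  {ae leb, forall g, K g -> P g} -> {ae leb, forall g, P g}.
Proof.
move=> PG [N [mN N0 NP]].
(* Integer matrices form a countable type, so unpickling them enumerates the lattice. *)
pose F (k : nat) := oapp (fun z : 'rV[int]_n => [set g | N (cmul G (map_mx intr z) g)])
  set0 (choice.unpickle k).
apply: (@negligibleS _ _ _ _ (\bigcup_k F k)); last first.
  apply: negligible_bigcup => k; rewrite /F; case: choice.unpickle => [z|]; last exact: negligible_set0.
  apply/negligibleP; first exact: measurable_cmul_preimage.
  exact: etrans (lebesgue_cmul G _ mN) N0.
move=> g nPg; have [p pZ pK] := unit_cell_cover G g.
pose z : 'rV[int]_n := \row_j Num.floor (p ord0 j).
have zp : map_mx intr z = p by apply/rowP => j; rewrite !mxE floorK.
exists (choice.pickle z) => //; rewrite /F choice.pickleK /= zp; apply: NP => /= H.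
by apply: nPg; exact: PG pZ (H pK).
Qed.

End Asymptotics.

Theorem theorem2p2 (R : realType) (n s : nat) (G : rational_carnot R n s)
    (hQ : (3 <= hausdorff_dim G)%N)
    (lam : nat -> R) (lam_gt0 : forall i, (1 <= i <= s)%N -> 0 < lam i)
    (wdist_triangle : forall x y z : 'rV[R]_n,
      wdist G lam x z <= wdist G lam x y + wdist G lam y z)
    (C eps : R) (C_gt0 : 0 < C) (eps_gt0 : 0 < eps) :
  {ae lebesgue_rV R n, forall g : 'rV[R]_n,
    (fun N : nat => (nb_solutions G lam C g N)%:R : R) =
    (fun N : nat =>
      unit_ball_volume G lam * C ^+ hausdorff_dim G * ln (N%:R : R))
    +O_\oo (fun N : nat =>
      (ln (N%:R : R)) `^ 2^-1 * (ln (ln (N%:R : R))) `^ (3 / 2 + eps))}.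
Proof.
pose P (g : 'rV[R]_n) := exists A : R, forall N : nat, 1 <= ln (ln (N%:R : R)) ->
  `|(nb_solutions G lam C g N)%:R -
      unit_ball_volume G lam * C ^+ hausdorff_dim G * ln N%:R| <=
    A * (ln N%:R `^ 2^-1 * ln (ln N%:R) `^ (3 / 2 + eps)).
have aeP : {ae lebesgue_rV R n, forall g : 'rV[R]_n, P g}.
  apply: (@ae_unit_cell_invariant _ _ _ G).
    move=> p g pZ [A HA]; exists A => N Nl; 
    rewrite -(nb_solutions_cmul C lam_gt0 wdist_triangle g N pZ).
    exact: HA.
  by have := ae_unit_cell_asymptotics lam_gt0 wdist_triangle hQ (ltW C_gt0) eps_gt0.
apply: filterS aeP => g [A HA]; apply/eqaddOP.
near=> k; near=> N.
have llN : 1 <= ln (ln (N%:R : R)).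
  (* The threshold e^e makes the iterated logarithm at least 1. *)
  have NE : expR (expR 1) <= N%:R :> R by near: N; exact: nbhs_infty_ger.
  have e1 : expR 1 <= ln (N%:R : R).
    by rewrite -[leLHS]expRK ler_ln ?posrE ?expR_gt0// (lt_le_trans (expR_gt0 _) NE).
  by rewrite -[leLHS]expRK ler_ln ?posrE ?expR_gt0// (lt_le_trans (expR_gt0 _) e1).
apply: (le_trans (HA N llN)); rewrite [X in _ <= _ * X]ger0_norm; last first.
  by rewrite mulr_ge0 ?powR_ge0.
rewrite ler_wpM2r ?mulr_ge0 ?powR_ge0//.
Unshelve. all: by end_near.
Qed.
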